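(* If $f\in\mathcal{C}$ is bounded, with second Taylor coefficient $a_2=f''(0)/2$, then there exists a constant $b>-\frac12$ such that $$\mathrm{Re}\{a_2f(z)\}\geq b>-\frac12$$ for all $z\in\mathbb{D}$.
   Context: $\mathbb{D}$ is the open unit disk in $\mathbb{C}$. $\mathcal{C}$ is the class of convex mappings: functions $f$ analytic and univalent in $\mathbb{D}$ with $f(0)=0$, $f'(0)=1$ and $f(\mathbb{D})$ convex. *)

(* Defs.v *)
From Stdlib Require Import Reals.
From Coquelicot Require Import Coquelicot.

Open Scope R_scope.

Definition unit_disk (z : C) : Prop := Cmod z < 1.

(* [ex_derive] at type [C -> C] is over the field C, i.e. it is complex
   differentiability. Functions are total on C; values outside the disk play
   no role. *)
Definition analytic_in_disk (f : C -> C) : Prop :=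
  forall z : C, unit_disk z -> @ex_derive C_AbsRing C_NormedModule f z.

Definition univalent_in_disk (f : C -> C) : Prop :=
  forall z w : C, unit_disk z -> unit_disk w -> f z = f w -> z = w.

Definition disk_image (f : C -> C) (w : C) : Prop :=
  exists z : C, unit_disk z /\ f z = w.

Definition convex_set (A : C -> Prop) : Prop :=
  forall (u v : C) (t : R), A u -> A v -> 0 <= t <= 1 ->
    A (RtoC (1 - t) * u + RtoC t * v)%C.

Definition bounded_set (A : C -> Prop) : Prop :=
  exists M : R, forall w : C, A w -> Cmod w <= M.

Record convex_mapping (f : C -> C) : Prop := {
  convex_mapping_analytic : analytic_in_disk f;
  convex_mapping_univalent : univalent_in_disk f;
  convex_mapping_zero : f (RtoC 0) = RtoC 0;
  convex_mapping_derive : C_derive f (RtoC 0) = RtoC 1;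
  convex_mapping_image : convex_set (disk_image f)
}.

Definition second_taylor_coeff (f : C -> C) : C :=
  (C_derive (C_derive f) (RtoC 0) / RtoC 2)%C.

(* Main.v *)
Require Import Defs.
From Stdlib Require Import Reals.
From Coquelicot Require Import Coquelicot.
From Stdlib Require Import Lra Lia Psatz Classical ClassicalEpsilon.

Open Scope R_scope.

(* For [w = f s] in the image let [R(w) = (1 - |s|^2) |f'(s)|] be the conformal radius of
   the image seen from [w].  Subordinating [(1 - t) f + t (f o m)] to [f], where [m] is a disk
   automorphism with [m 0 = s], shows that [R] is concave along the segment from [0] to [w];
   since [R = 1 + 2 Re (a2 w) + o(|w|)] at [0], this gives [R(w) <= 1 + 2 Re (a2 w)], and in
   particular [Re (a2 f) > -1/2].  If the infimum were [-1/2] there would be a boundary point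
   [v] with [1 + 2 Re (a2 v) = 0].  Then [(f + v) / 2] is subordinate to [f] with equality in
   the Schwarz-Pick lemma, so the image is invariant under the dilation of ratio [2] centred at
   [v], which is impossible for a bounded domain. *)

(** * Complex differentiability *)

(** The strict inequality at each single point is cheap, because a conformal radius is positive; the
    content is the uniform gap. The half-plane map [z / (1 - z)] has [a2 = 1] and the infimum of its
    real part is exactly [-1/2]: a half-plane does admit dilations about its boundary points.
    Boundedness therefore serves twice, to trap a limit value [v] and to exclude the dilation.
    Complex differentiability by itself says nothing about [f'], whereas [a2] and the expansion of
    [R] require [f'] to be differentiable at 0; this is what forces the route through Goursat and
    Cauchy. No power series occur: removable singularities are handled by the difference quotient
    [slope], completed by its limit value, and the maximum principle is obtained by real calculus
    along lines once second derivatives exist. *)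

Definition ccont (f : C -> C) (z : C) : Prop :=
  forall eps, 0 < eps -> exists d, 0 < d /\
    forall w, Cmod (w - z) < d -> Cmod (f w - f z) < eps.

(** The final inequality is non-strict so that [w = z] needs no exclusion, and the derivative is an
    explicit value, so that a function and its successive derivatives can be passed around as
    separate arguments. *)
Definition cdiff (f : C -> C) (z l : C) : Prop :=
  forall eps, 0 < eps -> exists d, 0 < d /\
    forall w, Cmod (w - z) < d ->
      Cmod (f w - f z - l * (w - z)) <= eps * Cmod (w - z).

(** Caratheodory's difference quotient, completed at [w = z] by the candidate derivative [l]. It
    later plays the role of a function with a removed singularity. *)
Definition slope (f : C -> C) (z l w : C) : C :=
  if Ceq_dec w z then l else ((f w - f z) / (w - z))%C.

Lemma Cmod_sub_sym (z w : C) : Cmod (z - w) = Cmod (w - z).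
Proof. rewrite <- Cmod_opp. f_equal. ring. Qed.

Lemma Cmod_sub_self (z : C) : Cmod (z - z) = 0.
Proof. replace (z - z)%C with (RtoC 0) by ring. apply Cmod_0. Qed.

Lemma Cmod_sub_triangle (u v w : C) : Cmod (u - w) <= Cmod (u - v) + Cmod (v - w).
Proof.
replace (u - w)%C with ((u - v) + (v - w))%C by ring. apply Cmod_triangle.
Qed.

Lemma Cmod_le_add_sub (u v : C) : Cmod u <= Cmod v + Cmod (u - v).
Proof.
replace u with (v + (u - v))%C at 1 by ring. apply Cmod_triangle.
Qed.

Lemma Cmod_sub_neq (u v : C) : u <> v -> 0 < Cmod (u - v).
Proof. intros H. apply Cmod_gt_0. now apply Cminus_eq_contra. Qed.

Lemma Cmod_le_sum (z : C) : Cmod z <= Rabs (fst z) + Rabs (snd z).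
Proof.
replace z with (RtoC (fst z) + Ci * RtoC (snd z))%C at 1
  by (destruct z; unfold RtoC, Ci, Cplus, Cmult; simpl; f_equal; ring).
eapply Rle_trans. apply Cmod_triangle.
rewrite Cmod_mult, Cmod_Ci, !Cmod_R. lra.
Qed.

Lemma Cmod_fst (z : C) : Rabs (fst z) <= Cmod z.
Proof. eapply Rle_trans; [apply Rmax_l | apply Rmax_Cmod]. Qed.

Lemma Cmod_snd (z : C) : Rabs (snd z) <= Cmod z.
Proof. eapply Rle_trans; [apply Rmax_r | apply Rmax_Cmod]. Qed.

Lemma Cmod_sqr (z : C) : Cmod z ^ 2 = fst z ^ 2 + snd z ^ 2.
Proof. exact (Cmod2_alt z). Qed.

Lemma ccont_continuous (f : C -> C) (z : C) :
  ccont f z <->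
  @continuous (AbsRing_UniformSpace C_AbsRing) (AbsRing_UniformSpace C_AbsRing) f z.
Proof.
split; intros H.
- intros P [e He]. destruct (H e (cond_pos e)) as (d & Hd & Hw).
  exists (mkposreal d Hd). intros w Hb. apply He. now apply Hw.
- intros eps He.
  destruct (H _ (ex_intro _ (mkposreal eps He) (fun y Hy => Hy))) as [d Hd].
  exists d. split. apply cond_pos. intros w Hw. now apply (Hd w).
Qed.

Lemma ccont_const (k z : C) : ccont (fun _ => k) z.
Proof.
intros eps He. exists 1. split. lra. intros w _. now rewrite Cmod_sub_self.
Qed.

Lemma ccont_id (z : C) : ccont (fun w => w) z.
Proof. intros eps He. exists eps. now split. Qed.

Lemma ccont_plus (f g : C -> C) (z : C) :
  ccont f z -> ccont g z -> ccont (fun w => f w + g w)%C z.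
Proof.
rewrite !ccont_continuous. exact (@continuous_plus (AbsRing_UniformSpace C_AbsRing) C_AbsRing (AbsRing_NormedModule C_AbsRing) f g z).
Qed.

Lemma ccont_mult (f g : C -> C) (z : C) :
  ccont f z -> ccont g z -> ccont (fun w => f w * g w)%C z.
Proof.
rewrite !ccont_continuous. exact (@continuous_mult (AbsRing_UniformSpace C_AbsRing) C_AbsRing f g z).
Qed.

Lemma ccont_comp (f g : C -> C) (z : C) :
  ccont g z -> ccont f (g z) -> ccont (fun w => f (g w)) z.
Proof.
intros Hg Hf eps He. destruct (Hf eps He) as (d & Hd & Hw).
destruct (Hg d Hd) as (d' & Hd' & Hw'). exists d'. split; [easy|].
intros w Hb. now apply Hw, Hw'.
Qed.

Lemma ccont_Cinv (z : C) : z <> 0 -> ccont Cinv z.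
Proof.
intros Hz eps He. assert (Hm : 0 < Cmod z) by now apply Cmod_gt_0.
set (m := Cmod z) in *.
assert (He2 : 0 < eps * (m * m) / 2).
{ apply Rdiv_lt_0_compat; [|lra]. apply Rmult_lt_0_compat; [lra|]. nra. }
exists (Rmin (m / 2) (eps * (m * m) / 2)). split.
{ apply Rmin_pos; lra. }
intros w Hw.
assert (H1 : Cmod (w - z) < m / 2) by (eapply Rlt_le_trans; [exact Hw|apply Rmin_l]).
assert (H2 : Cmod (w - z) < eps * (m * m) / 2)
  by (eapply Rlt_le_trans; [exact Hw|apply Rmin_r]).
assert (H3 : m / 2 < Cmod w).
{ pose proof (Cmod_le_add_sub z w). rewrite Cmod_sub_sym in H. fold m in H. lra. }
assert (Hw0 : w <> 0) by (apply Cmod_gt_0; lra).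
replace (/ w - / z)%C with (- ((w - z) / (w * z)))%C by (field; now split).
rewrite Cmod_opp, Cmod_div, Cmod_mult by now apply Cmult_neq_0.
fold m. apply Rlt_div_l; [nra|].
assert (eps * (m * m) / 2 <= eps * (Cmod w * m)) by nra. lra.
Qed.

Lemma ccont_local (f g : C -> C) (z : C) (d : R) :
  0 < d -> (forall w, Cmod (w - z) < d -> f w = g w) -> ccont g z -> ccont f z.
Proof.
intros Hd E H eps He. destruct (H eps He) as (d' & Hd' & Hw).
exists (Rmin d d'). split. now apply Rmin_pos. intros w Hb.
rewrite (E w), (E z).
- apply Hw. eapply Rlt_le_trans; [exact Hb|apply Rmin_r].
- now rewrite Cmod_sub_self.
- eapply Rlt_le_trans; [exact Hb|apply Rmin_l].
Qed.

Lemma ccont_neq0 (f : C -> C) (z : C) : ccont f z -> f z <> 0 ->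
  exists d, 0 < d /\ forall w, Cmod (w - z) < d -> f w <> 0.
Proof.
intros H H0. destruct (H (Cmod (f z))) as (d & Hd & Hw). now apply Cmod_gt_0.
exists d. split; [easy|]. intros w Hb E. specialize (Hw w Hb). rewrite E in Hw.
replace (0 - f z)%C with (- f z)%C in Hw by ring. rewrite Cmod_opp in Hw. lra.
Qed.

Lemma slope_eq (f : C -> C) (z l w : C) : (f w - f z = slope f z l w * (w - z))%C.
Proof.
unfold slope. destruct (Ceq_dec w z) as [->|H]. ring.
field. now apply Cminus_eq_contra.
Qed.

Lemma slope_at (f : C -> C) (z l : C) : slope f z l z = l.
Proof. unfold slope. now destruct (Ceq_dec z z). Qed.

Lemma slope_neq (f : C -> C) (z l w : C) :
  w <> z -> slope f z l w = ((f w - f z) / (w - z))%C.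
Proof. intros H. unfold slope. now destruct (Ceq_dec w z). Qed.

Lemma cdiff_slope (f : C -> C) (z l : C) : cdiff f z l -> ccont (slope f z l) z.
Proof.
intros H eps He. destruct (H (eps / 2)) as (d & Hd & Hw). lra.
exists d. split; [easy|]. intros w Hb. rewrite slope_at.
destruct (Ceq_dec w z) as [->|Hn].
{ rewrite slope_at, Cmod_sub_self. lra. }
specialize (Hw w Hb). rewrite (slope_eq f z l w) in Hw.
replace (slope f z l w * (w - z) - l * (w - z))%C
  with ((slope f z l w - l) * (w - z))%C in Hw by ring.
rewrite Cmod_mult in Hw. pose proof (Cmod_sub_neq _ _ Hn). nra.
Qed.

(* Caratheodory's form of differentiability: the algebraic rules reduce to continuity. *)
Lemma cdiff_factor (f phi : C -> C) (z : C) (d : R) :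
  0 < d -> ccont phi z ->
  (forall w, Cmod (w - z) < d -> (f w - f z = phi w * (w - z))%C) ->
  cdiff f z (phi z).
Proof.
intros Hd Hc E eps He. destruct (Hc eps He) as (d' & Hd' & Hw).
exists (Rmin d d'). split. now apply Rmin_pos. intros w Hb.
rewrite (E w) by (eapply Rlt_le_trans; [exact Hb|apply Rmin_l]).
replace (phi w * (w - z) - phi z * (w - z))%C with ((phi w - phi z) * (w - z))%C by ring.
rewrite Cmod_mult. apply Rmult_le_compat_r. apply Cmod_ge_0.
apply Rlt_le, Hw. eapply Rlt_le_trans; [exact Hb|apply Rmin_r].
Qed.

Lemma cdiff_eq_val (f : C -> C) (z l m : C) : cdiff f z l -> l = m -> cdiff f z m.
Proof. now intros H <-. Qed.

Lemma cdiff_local (f g : C -> C) (z l : C) (d : R) :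
  0 < d -> (forall w, Cmod (w - z) < d -> f w = g w) -> cdiff g z l -> cdiff f z l.
Proof.
intros Hd E H eps He. destruct (H eps He) as (d' & Hd' & Hw).
exists (Rmin d d'). split. now apply Rmin_pos. intros w Hb.
rewrite (E w), (E z).
- apply Hw. eapply Rlt_le_trans; [exact Hb|apply Rmin_r].
- now rewrite Cmod_sub_self.
- eapply Rlt_le_trans; [exact Hb|apply Rmin_l].
Qed.

Lemma cdiff_ext (f g : C -> C) (z l : C) :
  (forall w, f w = g w) -> cdiff g z l -> cdiff f z l.
Proof. intros E. apply (cdiff_local f g z l 1). lra. intros; apply E. Qed.

Lemma cdiff_ccont (f : C -> C) (z l : C) : cdiff f z l -> ccont f z.
Proof.
intros H. apply (ccont_local _ (fun w => f z + slope f z l w * (w + - z))%C z 1). lra.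
- intros w _. pose proof (slope_eq f z l w) as E.
  replace (f w) with (f z + (f w - f z))%C by ring. rewrite E. ring.
- apply ccont_plus. apply ccont_const. apply ccont_mult. now apply cdiff_slope.
  apply ccont_plus. apply ccont_id. apply ccont_const.
Qed.

Lemma cdiff_unique (f : C -> C) (z l m : C) : cdiff f z l -> cdiff f z m -> l = m.
Proof.
intros H1 H2. apply NNPP. intros Hn.
assert (Hm := Cmod_sub_neq _ _ Hn). set (k := Cmod (l - m)) in *.
destruct (H1 (k / 4)) as (d1 & Hd1 & E1). lra.
destruct (H2 (k / 4)) as (d2 & Hd2 & E2). lra.
set (d := Rmin d1 d2 / 2).
assert (Hd : 0 < Rmin d1 d2) by now apply Rmin_pos.
assert (Hmod : Cmod (z + RtoC d - z) = d).
{ replace (z + RtoC d - z)%C with (RtoC d) by ring. rewrite Cmod_R.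
  apply Rabs_pos_eq. unfold d. lra. }
pose proof (Rmin_l d1 d2). pose proof (Rmin_r d1 d2).
specialize (E1 (z + RtoC d)%C). specialize (E2 (z + RtoC d)%C). rewrite Hmod in E1, E2.
specialize (E1 ltac:(unfold d; lra)). specialize (E2 ltac:(unfold d; lra)).
set (A := (f (z + RtoC d) - f z)%C) in *.
set (w := (z + RtoC d - z)%C) in *.
pose proof (Cmod_sub_triangle (A - m * w) 0 (A - l * w)) as T.
replace (A - m * w - 0)%C with (A - m * w)%C in T by ring.
rewrite (Cmod_sub_sym 0) in T.
replace (A - l * w - 0)%C with (A - l * w)%C in T by ring.
replace (A - m * w - (A - l * w))%C with ((l - m) * w)%C in T by ring.
rewrite Cmod_mult, Hmod in T. fold k in T. assert (0 < d) by (unfold d; lra). nra.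
Qed.

Lemma cdiff_const (k z : C) : cdiff (fun _ => k) z 0.
Proof.
apply (cdiff_factor _ (fun _ => 0)%C z 1). lra. apply ccont_const. intros; ring.
Qed.

Lemma cdiff_id (z : C) : cdiff (fun w => w) z 1.
Proof.
apply (cdiff_factor _ (fun _ => RtoC 1) z 1). lra. apply ccont_const. intros; ring.
Qed.

Lemma cdiff_plus (f g : C -> C) (z l m : C) :
  cdiff f z l -> cdiff g z m -> cdiff (fun w => f w + g w)%C z (l + m).
Proof.
intros Hf Hg.
eapply cdiff_eq_val.
- apply (cdiff_factor _ (fun w => slope f z l w + slope g z m w)%C z 1). lra.
  + apply ccont_plus; now apply cdiff_slope.
  + intros w _. rewrite Cmult_plus_distr_r, <- !slope_eq. ring.
- now rewrite !slope_at.
Qed.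

Lemma cdiff_mult (f g : C -> C) (z l m : C) :
  cdiff f z l -> cdiff g z m -> cdiff (fun w => f w * g w)%C z (l * g z + f z * m).
Proof.
intros Hf Hg.
eapply cdiff_eq_val.
- apply (cdiff_factor _ (fun w => slope f z l w * g w + f z * slope g z m w)%C z 1). lra.
  + apply ccont_plus; apply ccont_mult; try (now apply cdiff_slope).
    now apply cdiff_ccont in Hg. apply ccont_const.
  + intros w _. 
    transitivity ((f w - f z) * g w + f z * (g w - g z))%C. ring.
    rewrite (slope_eq f z l w), (slope_eq g z m w). ring.
- simpl. now rewrite !slope_at.
Qed.

Lemma cdiff_scal (k : C) (f : C -> C) (z l : C) :
  cdiff f z l -> cdiff (fun w => k * f w)%C z (k * l).
Proof.
intros H. eapply cdiff_eq_val.
- apply (cdiff_mult (fun _ => k) f z 0 l); [apply cdiff_const|exact H].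
- ring.
Qed.

Lemma cdiff_opp (f : C -> C) (z l : C) : cdiff f z l -> cdiff (fun w => - f w)%C z (- l).
Proof.
intros H. apply (cdiff_ext _ (fun w => - (1) * f w)%C). intros; ring.
eapply cdiff_eq_val. apply cdiff_scal, H. ring.
Qed.

Lemma cdiff_minus (f g : C -> C) (z l m : C) :
  cdiff f z l -> cdiff g z m -> cdiff (fun w => f w - g w)%C z (l - m).
Proof. intros Hf Hg. apply (cdiff_plus f (fun w => - g w)%C). easy. now apply cdiff_opp. Qed.

Lemma cdiff_comp (f g : C -> C) (z l m : C) :
  cdiff g z m -> cdiff f (g z) l -> cdiff (fun w => f (g w)) z (l * m).
Proof.
intros Hg Hf. eapply cdiff_eq_val.
- apply (cdiff_factor _ (fun w => slope f (g z) l (g w) * slope g z m w)%C z 1). lra.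
  + apply ccont_mult; [|now apply cdiff_slope].
    apply (ccont_comp (slope f (g z) l) g). now apply cdiff_ccont in Hg. now apply cdiff_slope.
  + intros w _. rewrite (slope_eq f (g z) l (g w)), (slope_eq g z m w). ring.
- simpl. now rewrite !slope_at.
Qed.

Lemma cdiff_Cinv (z : C) : z <> 0 -> cdiff Cinv z (- / (z * z)).
Proof.
intros Hz. destruct (ccont_neq0 _ _ (ccont_id z) Hz) as (d & Hd & Hw).
eapply cdiff_eq_val.
- apply (cdiff_factor _ (fun w => - (/ w) * / z)%C z d Hd).
  + apply ccont_mult; [|apply ccont_const].
    apply (ccont_comp Copp Cinv). now apply ccont_Cinv.
    apply (ccont_local _ (fun w => - (1) * w)%C _ 1). lra. intros; ring.
    apply ccont_mult. apply ccont_const. apply ccont_id.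
  + intros w Hb. field. split; [easy|]. now apply Hw.
- simpl. field. easy.
Qed.

Lemma cdiff_inv (g : C -> C) (z m : C) :
  cdiff g z m -> g z <> 0 -> cdiff (fun w => / g w)%C z (- m / (g z * g z)).
Proof.
intros Hg H0. eapply cdiff_eq_val.
- apply (cdiff_comp Cinv g). exact Hg. now apply cdiff_Cinv.
- field. easy.
Qed.

Lemma cdiff_div (f g : C -> C) (z l m : C) :
  cdiff f z l -> cdiff g z m -> g z <> 0 ->
  cdiff (fun w => f w / g w)%C z ((l * g z - f z * m) / (g z * g z)).
Proof.
intros Hf Hg H0. eapply cdiff_eq_val.
- apply (cdiff_mult f (fun w => / g w)%C). exact Hf. apply cdiff_inv; [exact Hg|exact H0].
- field. easy.
Qed.

Lemma cdiff_slope_away (f : C -> C) (z l w m : C) :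
  w <> z -> cdiff f w m -> exists k, cdiff (slope f z l) w k.
Proof.
intros Hn Hf. eexists.
apply (cdiff_local _ (fun x => (f x - f z) / (x - z))%C w _ (Cmod (w - z))).
- now apply Cmod_sub_neq.
- intros x Hx. apply slope_neq. intros ->. rewrite Cmod_sub_sym in Hx. lra.
- apply cdiff_div.
  + apply cdiff_minus. exact Hf. apply cdiff_const.
  + apply cdiff_minus. apply cdiff_id. apply cdiff_const.
  + now apply Cminus_eq_contra.
Qed.

Lemma cdiff_is_derive (f : C -> C) (z l : C) :
  cdiff f z l <-> @is_derive C_AbsRing C_NormedModule f z l.
Proof.
split.
- intros H. split. apply is_linear_scal_l.
  intros x Hx. apply (@is_filter_lim_locally_unique C_AbsRing (AbsRing_NormedModule C_AbsRing)) in Hx. subst x.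
  intros eps. destruct (H eps (cond_pos eps)) as (d & Hd & Hw).
  exists (mkposreal d Hd). intros w Hb. 
  assert (E := Hw w Hb).
  change (Cmod (f w - f z - (w - z) * l) <= eps * Cmod (w - z)).
  now rewrite (Cmult_comm (w - z)).
- intros [_ H] eps He.
  destruct (H z (fun P HP => HP) (mkposreal eps He)) as [d Hd].
  exists d. split. apply cond_pos. intros w Hw.
  specialize (Hd w Hw).
  change (Cmod (f w - f z - (w - z) * l) <= eps * Cmod (w - z)) in Hd.
  now rewrite (Cmult_comm (w - z)) in Hd.
Qed.

(** * Curves and complex-valued integrals *)

Definition pcont (g : R -> C) (t : R) : Prop :=
  @continuous R_UniformSpace (AbsRing_UniformSpace C_AbsRing) g t.

(** Componentwise, so that the real fundamental theorem of calculus and product rule apply to each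
    coordinate; [pder_eps] supplies the norm form that the chain rule needs. *)
Definition pder (g : R -> C) (t : R) (l : C) : Prop :=
  is_derive (fun s => fst (g s)) t (fst l) /\ is_derive (fun s => snd (g s)) t (snd l).

Definition CI (g : R -> C) (a b : R) : C :=
  (RInt (fun t => fst (g t)) a b, RInt (fun t => snd (g t)) a b).

(** Endpoints come in either order, because primitives are integrated from a centre to points on any
    side of it. *)
Definition between (a b t : R) : Prop := Rmin a b <= t <= Rmax a b.

Lemma pcont_eps (g : R -> C) (t : R) :
  pcont g t <-> forall eps, 0 < eps -> exists d, 0 < d /\
    forall s, Rabs (s - t) < d -> Cmod (g s - g t) < eps.
Proof.
split; intros H.
- intros eps He.
  destruct (H _ (ex_intro _ (mkposreal eps He) (fun y Hy => Hy))) as [d Hd].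
  exists d. split. apply cond_pos. intros w Hw. now apply (Hd w).
- intros P [e He]. destruct (H e (cond_pos e)) as (d & Hd & Hw).
  exists (mkposreal d Hd). intros w Hb. apply He. now apply Hw.
Qed.

Lemma pcont_fst (g : R -> C) (t : R) : pcont g t -> continuous (fun s => fst (g s)) t.
Proof.
rewrite pcont_eps. intros H P [e He]. destruct (H e (cond_pos e)) as (d & Hd & Hw).
exists (mkposreal d Hd). intros s Hs. apply He.
eapply Rle_lt_trans; [|apply (Hw s Hs)]. apply (Cmod_fst (g s - g t)).
Qed.

Lemma pcont_snd (g : R -> C) (t : R) : pcont g t -> continuous (fun s => snd (g s)) t.
Proof.
rewrite pcont_eps. intros H P [e He]. destruct (H e (cond_pos e)) as (d & Hd & Hw).
exists (mkposreal d Hd). intros s Hs. apply He.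
eapply Rle_lt_trans; [|apply (Hw s Hs)]. apply (Cmod_snd (g s - g t)).
Qed.

Lemma pcont_const (k : C) (t : R) : pcont (fun _ => k) t.
Proof. apply continuous_const. Qed.

Lemma pcont_plus (g h : R -> C) (t : R) :
  pcont g t -> pcont h t -> pcont (fun s => g s + h s)%C t.
Proof. exact (@continuous_plus R_UniformSpace C_AbsRing (AbsRing_NormedModule C_AbsRing) g h t). Qed.

Lemma pcont_mult (g h : R -> C) (t : R) :
  pcont g t -> pcont h t -> pcont (fun s => g s * h s)%C t.
Proof. exact (@continuous_mult R_UniformSpace C_AbsRing g h t). Qed.

Lemma pcont_comp (f : C -> C) (g : R -> C) (t : R) :
  pcont g t -> ccont f (g t) -> pcont (fun s => f (g s)) t.
Proof.
rewrite !pcont_eps. intros Hg Hf eps He. destruct (Hf eps He) as (d & Hd & Hw).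
destruct (Hg d Hd) as (d' & Hd' & Hw'). exists d'. split; [easy|].
intros w Hb. now apply Hw, Hw'.
Qed.

Lemma is_derive_eps (g : R -> R) (t l : R) :
  is_derive g t l <-> forall eps, 0 < eps -> exists d, 0 < d /\
    forall s, Rabs (s - t) < d -> Rabs (g s - g t - l * (s - t)) <= eps * Rabs (s - t).
Proof.
split.
- intros [_ H] eps He.
  destruct (H t (fun P HP => HP) (mkposreal eps He)) as [d Hd].
  exists d. split. apply cond_pos. intros w Hw. specialize (Hd w Hw).
  change (Rabs (g w - g t - (w - t) * l) <= eps * Rabs (w - t)) in Hd.
  now rewrite (Rmult_comm (w - t)) in Hd.
- intros H. split. apply is_linear_scal_l.
  intros x Hx.
  apply (@is_filter_lim_locally_unique R_AbsRing (AbsRing_NormedModule R_AbsRing)) in Hx. subst x.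
  intros eps. destruct (H eps (cond_pos eps)) as (d & Hd & Hw).
  exists (mkposreal d Hd). intros w Hb. assert (E := Hw w Hb).
  change (Rabs (g w - g t - (w - t) * l) <= eps * Rabs (w - t)).
  now rewrite (Rmult_comm (w - t)).
Qed.

Lemma pder_eps (g : R -> C) (t : R) (l : C) :
  pder g t l <-> forall eps, 0 < eps -> exists d, 0 < d /\
    forall s, Rabs (s - t) < d ->
      Cmod (g s - g t - l * RtoC (s - t)) <= eps * Rabs (s - t).
Proof.
assert (E : forall s, (g s - g t - l * RtoC (s - t))%C =
  (fst (g s) - fst (g t) - fst l * (s - t), snd (g s) - snd (g t) - snd l * (s - t))).
{ intros s. destruct (g s), (g t), l.
  unfold Cminus, Cplus, Copp, Cmult, RtoC; simpl. f_equal; ring. }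
split.
- intros [H1 H2]. rewrite is_derive_eps in H1, H2. intros eps He.
  destruct (H1 (eps / 2)) as (d1 & Hd1 & E1). lra.
  destruct (H2 (eps / 2)) as (d2 & Hd2 & E2). lra.
  exists (Rmin d1 d2). split. now apply Rmin_pos.
  intros s Hs. rewrite E. eapply Rle_trans. apply Cmod_le_sum.
  specialize (E1 s (Rlt_le_trans _ _ _ Hs (Rmin_l _ _))).
  specialize (E2 s (Rlt_le_trans _ _ _ Hs (Rmin_r _ _))). simpl. lra.
- intros H. split; apply is_derive_eps; intros eps He;
  destruct (H eps He) as (d & Hd & Hs); exists d; (split; [easy|]); intros s Hb;
  (eapply Rle_trans; [|apply (Hs s Hb)]); rewrite E.
  apply (Cmod_fst (_, _)). apply (Cmod_snd (_, _)).
Qed.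

Lemma pder_pcont (g : R -> C) (t : R) (l : C) : pder g t l -> pcont g t.
Proof.
rewrite pder_eps, pcont_eps. intros H eps He. destruct (H 1) as (d & Hd & Hs). lra.
set (k := 1 + Cmod l). assert (Hk : 0 < k) by (pose proof (Cmod_ge_0 l); unfold k; lra).
exists (Rmin d (eps / k)). split. apply Rmin_pos; [easy|]. now apply Rdiv_lt_0_compat.
intros s Hb. specialize (Hs s (Rlt_le_trans _ _ _ Hb (Rmin_l _ _))).
assert (Hb2 := Rlt_le_trans _ _ _ Hb (Rmin_r _ _)).
apply Rlt_div_r in Hb2; [|easy].
pose proof (Cmod_le_add_sub (g s - g t) (l * RtoC (s - t))) as T.
rewrite Cmod_mult, Cmod_R in T. unfold k in Hb2. lra.
Qed.

Lemma pder_comp (f : C -> C) (g : R -> C) (t : R) (l m : C) :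
  pder g t m -> cdiff f (g t) l -> pder (fun s => f (g s)) t (l * m).
Proof.
intros Hg Hf. assert (Hc := pder_pcont _ _ _ Hg). rewrite pcont_eps in Hc.
rewrite pder_eps in Hg |- *. intros eps He.
set (k := 1 + Cmod l + Cmod m).
assert (Hk : 0 < k) by (pose proof (Cmod_ge_0 l); pose proof (Cmod_ge_0 m); unfold k; lra).
pose proof (Cmod_ge_0 l). pose proof (Cmod_ge_0 m).
(* With [e <= 1] the increment of [g] is at most [k * r], where [r] is [Rabs (s - t)]. The errors of
   [f] and of [g] then contribute at most [e * k * r] each, hence the factor [2 * k]. *)
set (e := Rmin 1 (eps / (2 * k))).
assert (He0 : 0 < e) by (apply Rmin_pos; [lra|apply Rdiv_lt_0_compat; lra]).
assert (He1 : e <= 1) by apply Rmin_l.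
assert (He2 : e * (2 * k) <= eps).
{ assert (e <= eps / (2 * k)) by apply Rmin_r. apply Rle_div_r; lra. }
destruct (Hf e He0) as (d & Hd & Hw).
destruct (Hg e He0) as (d1 & Hd1 & Hw1).
destruct (Hc d Hd) as (d2 & Hd2 & Hw2).
exists (Rmin d1 d2). split. now apply Rmin_pos.
intros s Hb. specialize (Hw1 s (Rlt_le_trans _ _ _ Hb (Rmin_l _ _))).
specialize (Hw2 s (Rlt_le_trans _ _ _ Hb (Rmin_r _ _))).
specialize (Hw _ Hw2).
set (x := RtoC (s - t)) in *.
assert (Hx : Cmod x = Rabs (s - t)) by apply Cmod_R.
replace (f (g s) - f (g t) - l * m * x)%C with
  ((f (g s) - f (g t) - l * (g s - g t)) + l * (g s - g t - m * x))%C by ring.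
eapply Rle_trans. apply Cmod_triangle. rewrite Cmod_mult.
pose proof (Cmod_le_add_sub (g s - g t) (m * x)) as T.
rewrite Cmod_mult, Hx in T. pose proof (Rabs_pos (s - t)).
set (r := Rabs (s - t)) in *.
assert (Cmod (g s - g t) <= k * r) by (unfold k; nra).
assert (Cmod l * Cmod (g s - g t - m * x) <= k * (e * r)).
{ apply Rmult_le_compat; try assumption. apply Cmod_ge_0. unfold k; lra. }
assert (e * Cmod (g s - g t) <= e * (k * r)) by (apply Rmult_le_compat_l; lra).
assert (e * (2 * k) * r <= eps * r) by (apply Rmult_le_compat_r; lra). lra.
Qed.

Lemma pder_RtoC (t : R) : pder RtoC t 1.
Proof.
split; simpl. apply (is_derive_id t). apply (is_derive_const 0 t).
Qed.

Lemma pder_eq_val (g : R -> C) (t : R) (l m : C) : pder g t l -> l = m -> pder g t m.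
Proof. now intros H <-. Qed.

Lemma pder_line (a v : C) (t : R) : pder (fun s => a + RtoC s * v)%C t v.
Proof.
apply (pder_eq_val _ _ (v * 1)%C); [|ring].
apply (pder_comp (fun z => a + z * v)%C RtoC). apply pder_RtoC.
eapply cdiff_eq_val.
- apply cdiff_plus. apply cdiff_const. apply (cdiff_mult (fun z => z) (fun _ => v)).
  apply cdiff_id. apply cdiff_const.
- simpl. ring.
Qed.

Lemma pder_ext (g h : R -> C) (t : R) (l : C) :
  (forall s, g s = h s) -> pder h t l -> pder g t l.
Proof.
intros E [H1 H2]. split; [eapply is_derive_ext; [|exact H1]|eapply is_derive_ext; [|exact H2]];
intros s; simpl; now rewrite E.
Qed.

Lemma ex_RInt_pcont_fst (g : R -> C) (a b : R) :
  (forall t, between a b t -> pcont g t) -> ex_RInt (fun t => fst (g t)) a b.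
Proof. intros H. apply (@ex_RInt_continuous R_CompleteNormedModule). intros t Ht. now apply pcont_fst, H. Qed.

Lemma ex_RInt_pcont_snd (g : R -> C) (a b : R) :
  (forall t, between a b t -> pcont g t) -> ex_RInt (fun t => snd (g t)) a b.
Proof. intros H. apply (@ex_RInt_continuous R_CompleteNormedModule). intros t Ht. now apply pcont_snd, H. Qed.

Lemma CI_ext (g h : R -> C) (a b : R) :
  (forall t, between a b t -> g t = h t) -> CI g a b = CI h a b.
Proof.
intros H. unfold CI. f_equal; apply RInt_ext; intros t Ht; rewrite H; try easy;
unfold between; lra.
Qed.

Lemma CI_plus (g h : R -> C) (a b : R) :
  (forall t, between a b t -> pcont g t) -> (forall t, between a b t -> pcont h t) ->
  CI (fun t => g t + h t)%C a b = (CI g a b + CI h a b)%C.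
Proof.
intros Hg Hh. unfold CI, Cplus; simpl. f_equal.
- apply (@RInt_plus R_CompleteNormedModule (fun t => fst (g t)) (fun t => fst (h t)));
  now apply ex_RInt_pcont_fst.
- apply (@RInt_plus R_CompleteNormedModule (fun t => snd (g t)) (fun t => snd (h t)));
  now apply ex_RInt_pcont_snd.
Qed.

Lemma CI_scal (k : C) (g : R -> C) (a b : R) :
  (forall t, between a b t -> pcont g t) ->
  CI (fun t => k * g t)%C a b = (k * CI g a b)%C.
Proof.
intros Hg. assert (H1 := ex_RInt_pcont_fst g a b Hg). assert (H2 := ex_RInt_pcont_snd g a b Hg).
unfold CI, Cmult; simpl. f_equal; apply is_RInt_unique.
- apply (is_RInt_minus (fun t => fst k * fst (g t)) (fun t => snd k * snd (g t)));
  [apply (is_RInt_scal (fun t => fst (g t)))|apply (is_RInt_scal (fun t => snd (g t)))];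
  now apply (@RInt_correct R_CompleteNormedModule).
- apply (is_RInt_plus (fun t => fst k * snd (g t)) (fun t => snd k * fst (g t)));
  [apply (is_RInt_scal (fun t => snd (g t)))|apply (is_RInt_scal (fun t => fst (g t)))];
  now apply (@RInt_correct R_CompleteNormedModule).
Qed.

Lemma CI_minus (g h : R -> C) (a b : R) :
  (forall t, between a b t -> pcont g t) -> (forall t, between a b t -> pcont h t) ->
  CI (fun t => g t - h t)%C a b = (CI g a b - CI h a b)%C.
Proof.
intros Hg Hh. replace (CI g a b - CI h a b)%C with (CI g a b + (- (1)) * CI h a b)%C by ring.
rewrite <- CI_scal by easy. rewrite <- CI_plus.
- apply CI_ext. intros; ring.
- easy.
- intros t Ht. apply pcont_mult. apply pcont_const. now apply Hh.
Qed.

Lemma CI_Chasles (g : R -> C) (a b c : R) :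
  (forall t, between a b t -> pcont g t) -> (forall t, between b c t -> pcont g t) ->
  (CI g a b + CI g b c)%C = CI g a c.
Proof.
intros H1 H2. unfold CI, Cplus; simpl. f_equal.
- apply (@RInt_Chasles R_CompleteNormedModule (fun t => fst (g t))); now apply ex_RInt_pcont_fst.
- apply (@RInt_Chasles R_CompleteNormedModule (fun t => snd (g t))); now apply ex_RInt_pcont_snd.
Qed.

Lemma RInt_bound (g : R -> R) (a b M : R) :
  ex_RInt g a b -> (forall t, between a b t -> Rabs (g t) <= M) ->
  Rabs (RInt g a b) <= M * Rabs (b - a).
Proof.
intros Hex H. destruct (Rle_dec a b) as [L|L].
- rewrite (Rabs_pos_eq (b - a)) by lra. rewrite (Rmult_comm M).
  apply abs_RInt_le_const; try easy. intros t Ht. apply H.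
  unfold between. rewrite Rmin_left, Rmax_right; lra.
- assert (L' : b <= a) by lra.
  rewrite <- (@opp_RInt_swap R_CompleteNormedModule) by now apply ex_RInt_swap.
  change (Rabs (- RInt g b a) <= M * Rabs (b - a)).
  rewrite Rabs_Ropp, (Rabs_minus_sym b a), (Rabs_pos_eq (a - b)) by lra.
  rewrite (Rmult_comm M).
  apply abs_RInt_le_const; try easy. now apply ex_RInt_swap. intros t Ht. apply H.
  unfold between. rewrite Rmin_right, Rmax_left; lra.
Qed.

(* Estimating the two components separately costs a factor 2 that never matters. *)
Lemma CI_bound (g : R -> C) (a b M : R) :
  (forall t, between a b t -> pcont g t) ->
  (forall t, between a b t -> Cmod (g t) <= M) ->
  Cmod (CI g a b) <= 2 * M * Rabs (b - a).
Proof.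
intros Hc H. eapply Rle_trans. apply Cmod_le_sum. unfold CI; simpl.
assert (H1 : Rabs (RInt (fun t => fst (g t)) a b) <= M * Rabs (b - a)).
{ apply RInt_bound. now apply ex_RInt_pcont_fst. intros t Ht.
  eapply Rle_trans. apply Cmod_fst. now apply H. }
assert (H2 : Rabs (RInt (fun t => snd (g t)) a b) <= M * Rabs (b - a)).
{ apply RInt_bound. now apply ex_RInt_pcont_snd. intros t Ht.
  eapply Rle_trans. apply Cmod_snd. now apply H. }
lra.
Qed.

Lemma CI_const (k : C) (a b : R) : CI (fun _ => k) a b = (k * RtoC (b - a))%C.
Proof.
unfold CI. rewrite !RInt_const. destruct k as [x y].
unfold scal, RtoC, Cmult; simpl. unfold mult; simpl. f_equal; ring.
Qed.

Lemma CI_derive (g dg : R -> C) (a b : R) :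
  (forall t, between a b t -> pder g t (dg t)) ->
  (forall t, between a b t -> pcont dg t) ->
  (CI dg a b = g b - g a)%C.
Proof.
intros H Hc. unfold CI. rewrite (surjective_pairing (g b - g a)%C). f_equal;
apply is_RInt_unique.
- apply (@is_RInt_derive R_CompleteNormedModule (fun t => fst (g t)) (fun t => fst (dg t))); intros t Ht.
  now apply H. now apply pcont_fst, Hc.
- apply (@is_RInt_derive R_CompleteNormedModule (fun t => snd (g t)) (fun t => snd (dg t))); intros t Ht.
  now apply H. now apply pcont_snd, Hc.
Qed.

(** * Mean value inequality and second-order estimates *)

Lemma segment_dist (a z : C) (t : R) :
  0 <= t <= 1 -> Cmod (a + RtoC t * (z - a) - a) <= Cmod (z - a).
Proof.
intros Ht. replace (a + RtoC t * (z - a) - a)%C with (RtoC t * (z - a))%C by ring.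
rewrite Cmod_mult, Cmod_R, Rabs_pos_eq by lra. pose proof (Cmod_ge_0 (z - a)). nra.
Qed.

(* Mean value inequality: apply the real mean value theorem to
   [t |-> Re (conj (g z - g a) * g (a + t (z - a)))]. *)
Lemma mean_value_ineq (g dg : C -> C) (a z : C) (M : R) :
  (forall w, Cmod (w - a) <= Cmod (z - a) -> cdiff g w (dg w)) ->
  (forall w, Cmod (w - a) <= Cmod (z - a) -> Cmod (dg w) <= M) ->
  Cmod (g z - g a) <= M * Cmod (z - a).
Proof.
intros Hd HM.
set (u := (g z - g a)%C). set (p := fun t => (a + RtoC t * (z - a))%C).
assert (Hder : forall t, 0 <= t <= 1 ->
  pder (fun s => Cconj u * g (p s))%C t (Cconj u * (dg (p t) * (z - a)))).
{ intros t Ht. apply (pder_eq_val _ _ (Cconj u * dg (p t) * (z - a))%C); [|ring].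
  apply (pder_comp (fun w => Cconj u * g w)%C p). apply pder_line.
  apply cdiff_scal, Hd. now apply segment_dist. }
destruct (MVT_gen (fun s => fst (Cconj u * g (p s))%C) 0 1
  (fun t => fst (Cconj u * (dg (p t) * (z - a)))%C)) as (t & Ht & E).
- intros t Ht. rewrite Rmin_left, Rmax_right in Ht by lra. apply Hder. lra.
- intros t Ht. rewrite Rmin_left, Rmax_right in Ht by lra.
  apply derivable_continuous_pt. eexists. apply is_derive_Reals, Hder. lra.
- rewrite Rmin_left, Rmax_right in Ht by lra.
  unfold p in E at 1 2. replace (a + RtoC 1 * (z - a))%C with z in E by ring.
  replace (a + RtoC 0 * (z - a))%C with a in E by ring.
  assert (E2 : fst (Cconj u * g z)%C - fst (Cconj u * g a)%C = Cmod u ^ 2).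
  { transitivity (fst (Cconj u * u)%C).
    - assert (K : forall v x y : C, fst (v * x)%C - fst (v * y)%C = fst (v * (x - y))%C)
        by (intros [] [] []; simpl; ring).
      apply K.
    - rewrite Cmod_sqr. destruct u. simpl. ring. }
  rewrite E2 in E. clear E2.
  assert (T := Cmod_fst (Cconj u * (dg (p t) * (z - a)))%C).
  rewrite !Cmod_mult, Cmod_conj in T.
  apply Rabs_le_between in T.
  assert (HM' := HM (p t) (segment_dist a z t Ht)).
  pose proof (Cmod_ge_0 u). pose proof (Cmod_ge_0 (z - a)).
  fold u.
  destruct (Req_dec (Cmod u) 0) as [U|U].
  + pose proof (Cmod_ge_0 (dg (p t))). rewrite U. nra.
  + apply (Rmult_le_reg_l (Cmod u)). lra.
    assert (Cmod u * (Cmod (dg (p t)) * Cmod (z - a)) <= Cmod u * (M * Cmod (z - a))).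
    { apply Rmult_le_compat_l. lra. apply Rmult_le_compat_r; lra. }
    lra.
Qed.

(** Two uses of the mean value inequality: [g1 w - g1 a] is at most [B * Cmod (z - a)] on the ball,
    and it is the derivative of [g w - g1 a * w]. The usual factor 1/2 is lost, which is
    harmless. *)
Lemma taylor2 (g g1 g2 : C -> C) (a z : C) (B : R) :
  (forall w, Cmod (w - a) <= Cmod (z - a) -> cdiff g w (g1 w)) ->
  (forall w, Cmod (w - a) <= Cmod (z - a) -> cdiff g1 w (g2 w)) ->
  (forall w, Cmod (w - a) <= Cmod (z - a) -> Cmod (g2 w) <= B) ->
  Cmod (g z - g a - g1 a * (z - a)) <= B * Cmod (z - a) ^ 2.
Proof.
intros H1 H2 HB.
assert (T := mean_value_ineq (fun w => g w - g1 a * w)%C (fun w => g1 w - g1 a)%C a z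
  (B * Cmod (z - a))).
replace (g z - g a - g1 a * (z - a))%C with (g z - g1 a * z - (g a - g1 a * a))%C by ring.
eapply Rle_trans. apply T.
- intros w Hw. apply cdiff_minus. now apply H1.
  apply (cdiff_eq_val _ _ (g1 a * 1)%C); [|ring]. apply cdiff_scal, cdiff_id.
- intros w Hw. eapply Rle_trans. apply (mean_value_ineq g1 g2 a w B).
  + intros x Hx. apply H2. lra.
  + intros x Hx. apply HB. lra.
  + apply Rmult_le_compat_l; [|easy]. eapply Rle_trans; [|apply (HB a)]. apply Cmod_ge_0.
    rewrite Cmod_sub_self. apply Cmod_ge_0.
- apply Req_le. ring.
Qed.

(** Subtracting [f a * w + m / 2 * (w - a)^2] from [F] leaves a function whose derivative
    [f w - f a - m * (w - a)] is [o(|w - a|)]. The mean value inequality, followed by division by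
    [z - a], gives the claim. *)
Lemma slope_cdiff_at (F f : C -> C) (a m : C) (d : R) :
  0 < d -> (forall w, Cmod (w - a) < d -> cdiff F w (f w)) -> cdiff f a m ->
  cdiff (slope F a (f a)) a (m / RtoC 2).
Proof.
intros Hd HF Hf eps He. destruct (Hf eps He) as (d' & Hd' & Hw).
exists (Rmin d d'). split. now apply Rmin_pos. intros z Hz.
assert (Hz1 := Rlt_le_trans _ _ _ Hz (Rmin_l _ _)).
assert (Hz2 := Rlt_le_trans _ _ _ Hz (Rmin_r _ _)).
rewrite slope_at. destruct (Ceq_dec z a) as [->|Hn].
{ rewrite slope_at. replace (f a - f a - m / RtoC 2 * (a - a))%C with (RtoC 0) by ring.
  rewrite Cmod_0, Cmod_sub_self. lra. }
assert (T := mean_value_ineq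
  (fun w => F w - f a * w - m / RtoC 2 * ((w - a) * (w - a)))%C
  (fun w => f w - f a - m * (w - a))%C a z (eps * Cmod (z - a))).
rewrite slope_neq by easy.
assert (Hza := Cminus_eq_contra _ _ Hn).
replace ((F z - F a) / (z - a) - f a - m / RtoC 2 * (z - a))%C with
  ((F z - f a * z - m / RtoC 2 * ((z - a) * (z - a)) -
    (F a - f a * a - m / RtoC 2 * ((a - a) * (a - a)))) / (z - a))%C by (field; easy).
rewrite Cmod_div by easy. apply Rle_div_l. now apply Cmod_gt_0.
apply T.
- intros w Hwa. eapply cdiff_eq_val.
  + apply cdiff_minus. apply cdiff_minus. apply HF. lra. apply cdiff_scal, cdiff_id.
    apply cdiff_scal. apply (cdiff_mult (fun w => w - a)%C (fun w => w - a)%C);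
    (apply cdiff_minus; [apply cdiff_id|apply cdiff_const]).
  + simpl. field.
- intros w Hwa. eapply Rle_trans. apply Hw. lra. apply Rmult_le_compat_l; lra.
Qed.

(** * Goursat's theorem *)

(** The contour integral around a rectangle, counterclockwise when [a <= b] and [c <= d]; [Ci] comes
    from [dz = i dt] on the vertical sides. *)
Definition rect_int (f : C -> C) (a b c d : R) : C :=
  (CI (fun s => f (s, c)) a b + Ci * CI (fun t => f (b, t)) c d
   - CI (fun s => f (s, d)) a b - Ci * CI (fun t => f (a, t)) c d)%C.

Definition in_box (a b c d : R) (z : C) : Prop := between a b (fst z) /\ between c d (snd z).

Lemma pder_horizontal (y t : R) : pder (fun s => (s, y)) t 1.
Proof.
apply (pder_ext _ (fun s => (0, y) + RtoC s * 1)%C); [|apply pder_line].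
intros s. unfold Cplus, Cmult, RtoC; simpl. f_equal; ring.
Qed.

Lemma pder_vertical (x t : R) : pder (fun s => (x, s)) t Ci.
Proof.
apply (pder_ext _ (fun s => (x, 0) + RtoC s * Ci)%C); [|apply pder_line].
intros s. unfold Cplus, Cmult, RtoC, Ci; simpl. f_equal; ring.
Qed.

Lemma pcont_horizontal (f : C -> C) (y t : R) :
  ccont f (t, y) -> pcont (fun s => f (s, y)) t.
Proof. intros H. apply (pcont_comp f (fun s => (s, y))); [|easy]. eapply pder_pcont, pder_horizontal. Qed.

Lemma pcont_vertical (f : C -> C) (x t : R) :
  ccont f (x, t) -> pcont (fun s => f (x, s)) t.
Proof. intros H. apply (pcont_comp f (fun s => (x, s))); [|easy]. eapply pder_pcont, pder_vertical. Qed.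

Lemma between_l (a b : R) : between a b a.
Proof. split. apply Rmin_l. apply Rmax_l. Qed.

Lemma between_r (a b : R) : between a b b.
Proof. split. apply Rmin_r. apply Rmax_r. Qed.

Lemma between_le (a b t : R) : a <= b -> (between a b t <-> a <= t <= b).
Proof. intros H. unfold between. now rewrite Rmin_left, Rmax_right. Qed.

Lemma between_comm (a b t : R) : between a b t -> between b a t.
Proof. unfold between. now rewrite Rmin_comm, Rmax_comm. Qed.

Lemma between_abs (a b t m r : R) : between a b t ->
  Rabs (a - m) < r -> Rabs (b - m) < r -> Rabs (t - m) < r.
Proof.
unfold between, Rmin, Rmax. destruct (Rle_dec a b); intros H1 H2 H3;
apply Rabs_lt_between in H2; apply Rabs_lt_between in H3; apply Rabs_lt_between; lra.
Qed.

Lemma between_dist (a b t : R) : between a b t -> Rabs (t - a) <= Rabs (b - a).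
Proof.
unfold between, Rmin, Rmax. destruct (Rle_dec a b); intros H.
- rewrite !Rabs_pos_eq; lra.
- rewrite !Rabs_left1; lra.
Qed.

Lemma rect_int_split (f : C -> C) (a m b c n d : R) :
  a <= m <= b -> c <= n <= d ->
  (forall z, in_box a b c d z -> ccont f z) ->
  rect_int f a b c d =
  (rect_int f a m c n + rect_int f m b c n + rect_int f a m n d + rect_int f m b n d)%C.
Proof.
intros Hm Hn Hc.
assert (Hh : forall y, c <= y <= d -> forall s, a <= s <= b -> pcont (fun s => f (s, y)) s).
{ intros y Hy s Hs. apply pcont_horizontal, Hc. split; simpl; rewrite between_le; lra. }
assert (Hv : forall x, a <= x <= b -> forall t, c <= t <= d -> pcont (fun t => f (x, t)) t).
{ intros x Hx t Ht. apply pcont_vertical, Hc. split; simpl; rewrite between_le; lra. }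
unfold rect_int.
rewrite <- (CI_Chasles (fun s => f (s, c)) a m b);
  try (intros s Hs; rewrite between_le in Hs by lra; apply Hh; lra).
rewrite <- (CI_Chasles (fun s => f (s, d)) a m b);
  try (intros s Hs; rewrite between_le in Hs by lra; apply Hh; lra).
rewrite <- (CI_Chasles (fun s => f (a, s)) c n d);
  try (intros s Hs; rewrite between_le in Hs by lra; apply Hv; lra).
rewrite <- (CI_Chasles (fun s => f (b, s)) c n d);
  try (intros s Hs; rewrite between_le in Hs by lra; apply Hv; lra).
ring.
Qed.

Lemma rect_int_minus (f h : C -> C) (a b c d : R) :
  (forall z, in_box a b c d z -> ccont f z) -> (forall z, in_box a b c d z -> ccont h z) ->
  rect_int (fun z => f z - h z)%C a b c d = (rect_int f a b c d - rect_int h a b c d)%C.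
Proof.
intros Hf Hh. unfold rect_int.
assert (L1 := between_l a b). assert (L2 := between_r a b).
assert (L3 := between_l c d). assert (L4 := between_r c d).
rewrite !(CI_minus (fun s => f (s, _)) (fun s => h (s, _)));
  try (intros s Hs; apply pcont_horizontal; (apply Hf || apply Hh); now split).
rewrite !(CI_minus (fun s => f (_, s)) (fun s => h (_, s)));
  try (intros s Hs; apply pcont_vertical; (apply Hf || apply Hh); now split).
ring.
Qed.

Lemma rect_int_bound (f : C -> C) (a b c d M : R) :
  (forall z, in_box a b c d z -> ccont f z) ->
  (forall z, in_box a b c d z -> Cmod (f z) <= M) ->
  Cmod (rect_int f a b c d) <= 4 * M * (Rabs (b - a) + Rabs (d - c)).
Proof.
intros Hf HM.
assert (L1 := between_l a b). assert (L2 := between_r a b).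
assert (L3 := between_l c d). assert (L4 := between_r c d).
assert (Hh : forall y, between c d y -> Cmod (CI (fun s => f (s, y)) a b) <= 2 * M * Rabs (b - a)).
{ intros y Hy. apply CI_bound; intros t Ht. apply pcont_horizontal, Hf. now split.
  apply HM. now split. }
assert (Hv : forall x, between a b x -> Cmod (Ci * CI (fun t => f (x, t)) c d)%C <= 2 * M * Rabs (d - c)).
{ intros y Hy. rewrite Cmod_mult, Cmod_Ci, Rmult_1_l. apply CI_bound; intros t Ht.
  apply pcont_vertical, Hf. now split. apply HM. now split. }
unfold rect_int, Cminus.
eapply Rle_trans; [apply Cmod_triangle|]. rewrite Cmod_opp.
eapply Rle_trans; [apply Rplus_le_compat_r, Cmod_triangle|]. rewrite Cmod_opp.
eapply Rle_trans; [apply Rplus_le_compat_r, Rplus_le_compat_r, Cmod_triangle|].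
specialize (Hh c L3) as H1. specialize (Hh d L4) as H2.
specialize (Hv a L1) as H3. specialize (Hv b L2) as H4. lra.
Qed.

Lemma rect_int_exact (P f : C -> C) (a b c d : R) :
  (forall z, in_box a b c d z -> ccont f z) ->
  (forall z, in_box a b c d z -> cdiff P z (f z)) ->
  rect_int f a b c d = 0.
Proof.
intros Hf HP.
assert (L1 := between_l a b). assert (L2 := between_r a b).
assert (L3 := between_l c d). assert (L4 := between_r c d).
assert (Hh : forall y, between c d y -> (CI (fun s => f (s, y)) a b = P (b, y) - P (a, y))%C).
{ intros y Hy. apply (CI_derive (fun s => P (s, y))); intros t Ht.
  - eapply pder_eq_val. apply (pder_comp P (fun s => (s, y))). apply pder_horizontal.
    apply HP. now split. ring.
  - apply pcont_horizontal, Hf. now split. }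
assert (Hv : forall x, between a b x -> (Ci * CI (fun t => f (x, t)) c d = P (x, d) - P (x, c))%C).
{ intros x Hx. rewrite <- CI_scal.
  apply (CI_derive (fun s => P (x, s))); intros t Ht.
  - eapply pder_eq_val. apply (pder_comp P (fun s => (x, s))). apply pder_vertical.
    apply HP. now split. ring.
  - apply pcont_mult. apply pcont_const. apply pcont_vertical, Hf. now split.
  - intros t Ht. apply pcont_vertical, Hf. now split. }
unfold rect_int. rewrite !Hh, !Hv by easy. ring.
Qed.

Lemma CI_swap (g : R -> C) (a b : R) :
  (forall t, between a b t -> pcont g t) -> (CI g b a = - CI g a b)%C.
Proof.
intros H. assert (E := CI_Chasles g a b a H (fun t Ht => H t (between_comm _ _ _ Ht))).
assert (Z : CI g a a = 0) by (unfold CI; rewrite !RInt_point; reflexivity).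
rewrite Z in E. transitivity (CI g a b + CI g b a - CI g a b)%C. ring. rewrite E. ring.
Qed.

Lemma rect_int_swap_x (f : C -> C) (a b c d : R) :
  (forall z, in_box a b c d z -> ccont f z) ->
  (rect_int f b a c d = - rect_int f a b c d)%C.
Proof.
intros Hf. unfold rect_int. rewrite !(CI_swap _ a b). ring.
all: intros t Ht; apply pcont_horizontal, Hf; split; try easy.
apply between_r. apply between_l.
Qed.

Lemma rect_int_swap_y (f : C -> C) (a b c d : R) :
  (forall z, in_box a b c d z -> ccont f z) ->
  (rect_int f a b d c = - rect_int f a b c d)%C.
Proof.
intros Hf. unfold rect_int. rewrite !(CI_swap _ c d). ring.
all: intros t Ht; apply pcont_vertical, Hf; split; try easy.
apply between_l. apply between_r.
Qed.

(** The last quarter needs no test: when the other three integrals are below [K], the triangle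
    inequality forces this one to reach [K]. *)
Definition quarter (f : C -> C) (q : R * R * (R * R)) : R * R * (R * R) :=
  let '((a, b), (c, d)) := q in
  let m := (a + b) / 2 in let n := (c + d) / 2 in
  let K := Cmod (rect_int f a b c d) / 4 in
  if Rle_dec K (Cmod (rect_int f a m c n)) then ((a, m), (c, n)) else
  if Rle_dec K (Cmod (rect_int f m b c n)) then ((m, b), (c, n)) else
  if Rle_dec K (Cmod (rect_int f a m n d)) then ((a, m), (n, d)) else ((m, b), (n, d)).

Definition is_half (a b a' b' : R) : Prop :=
  (a' = a /\ b' = (a + b) / 2) \/ (a' = (a + b) / 2 /\ b' = b).

Lemma quarter_spec (f : C -> C) (a b c d a' b' c' d' : R) :
  a <= b -> c <= d -> (forall z, in_box a b c d z -> ccont f z) ->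
  quarter f ((a, b), (c, d)) = ((a', b'), (c', d')) ->
  is_half a b a' b' /\ is_half c d c' d' /\
  Cmod (rect_int f a b c d) / 4 <= Cmod (rect_int f a' b' c' d').
Proof.
intros Hab Hcd Hc.
assert (S := rect_int_split f a ((a + b) / 2) b c ((c + d) / 2) d
  ltac:(lra) ltac:(lra) Hc).
unfold quarter, is_half.
destruct Rle_dec; [intros E; injection E; intros; subst; tauto|].
destruct Rle_dec; [intros E; injection E; intros; subst; tauto|].
destruct Rle_dec; [intros E; injection E; intros; subst; tauto|].
intros E; injection E as <- <- <- <-; repeat split; try tauto.
rewrite S at 1.
assert (T : Cmod (rect_int f a b c d) <= Cmod (rect_int f a ((a + b) / 2) c ((c + d) / 2))
  + Cmod (rect_int f ((a + b) / 2) b c ((c + d) / 2))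
  + Cmod (rect_int f a ((a + b) / 2) ((c + d) / 2) d)
  + Cmod (rect_int f ((a + b) / 2) b ((c + d) / 2) d)).
{ rewrite S.
  eapply Rle_trans; [apply Cmod_triangle|apply Rplus_le_compat_r].
  eapply Rle_trans; [apply Cmod_triangle|apply Rplus_le_compat_r]. apply Cmod_triangle. }
rewrite <- S. lra.
Qed.

Lemma nested_point (u v : nat -> R) :
  (forall n, u n <= u (S n)) -> (forall n, v (S n) <= v n) -> (forall n, u n <= v n) ->
  exists x, forall n, u n <= x <= v n.
Proof.
intros Hu Hv Huv.
assert (Gu : forall n m, u n <= u (n + m)%nat).
{ intros n m. induction m. rewrite Nat.add_0_r. lra.
  rewrite Nat.add_succ_r. specialize (Hu (n + m)%nat). lra. }
assert (Gv : forall n m, v (n + m)%nat <= v n).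
{ intros n m. induction m. rewrite Nat.add_0_r. lra.
  rewrite Nat.add_succ_r. specialize (Hv (n + m)%nat). lra. }
assert (G : forall n m, u n <= v m).
{ intros n m. specialize (Gu n m). specialize (Gv m n). rewrite Nat.add_comm in Gv.
  specialize (Huv (n + m)%nat). lra. }
destruct (completeness (fun x => exists n, x = u n)) as [x [H1 H2]].
- exists (v 0%nat). intros y [n ->]. apply G.
- now exists (u 0%nat), 0%nat.
- exists x. intros n. split. apply H1. now exists n. apply H2. intros y [m ->]. apply G.
Qed.

(** Bisection keeps an integral of modulus at least [K / 4 ^ n] on rectangles shrinking to one
    point. Near that point [f] is affine up to an error small relative to the diameter, and both the
    error and the perimeter shrink like [2 ^ n], so [K] cannot be positive. *)
Lemma goursat_ordered (f : C -> C) (a b c d : R) :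
  a <= b -> c <= d ->
  (forall z, in_box a b c d z -> exists l, cdiff f z l) ->
  rect_int f a b c d = 0.
Proof.
intros Hab Hcd Hf.
assert (Hc : forall z, in_box a b c d z -> ccont f z).
{ intros z Hz. destruct (Hf z Hz) as [l Hl]. now apply cdiff_ccont in Hl. }
set (q := fun n => Nat.iter n (quarter f) ((a, b), (c, d))).
set (x0 := fun n => fst (fst (q n))). set (x1 := fun n => snd (fst (q n))).
set (y0 := fun n => fst (snd (q n))). set (y1 := fun n => snd (snd (q n))).
set (K := Cmod (rect_int f a b c d)).
assert (E : forall n, q n = ((x0 n, x1 n), (y0 n, y1 n))).
{ intros n. unfold x0, x1, y0, y1. now destruct (q n) as [[? ?] [? ?]]. }
assert (I : forall n, (a <= x0 n <= x1 n /\ x1 n <= b) /\ (c <= y0 n <= y1 n /\ y1 n <= d) /\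
  x1 n - x0 n = (b - a) / 2 ^ n /\ y1 n - y0 n = (d - c) / 2 ^ n /\
  K / 4 ^ n <= Cmod (rect_int f (x0 n) (x1 n) (y0 n) (y1 n)) /\
  x0 n <= x0 (S n) /\ x1 (S n) <= x1 n /\ y0 n <= y0 (S n) /\ y1 (S n) <= y1 n).
{ assert (Q : forall n, a <= x0 n <= x1 n -> x1 n <= b -> c <= y0 n <= y1 n -> y1 n <= d ->
    is_half (x0 n) (x1 n) (x0 (S n)) (x1 (S n)) /\ is_half (y0 n) (y1 n) (y0 (S n)) (y1 (S n)) /\
    Cmod (rect_int f (x0 n) (x1 n) (y0 n) (y1 n)) / 4 <=
    Cmod (rect_int f (x0 (S n)) (x1 (S n)) (y0 (S n)) (y1 (S n)))).
  { intros n H1 H2 H3 H4. apply quarter_spec; try lra.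
    - intros z [Hz1 Hz2]. rewrite between_le in Hz1, Hz2 by lra. apply Hc.
      split; rewrite between_le; lra.
    - rewrite <- !E. reflexivity. }
  assert (J : forall n, (a <= x0 n <= x1 n /\ x1 n <= b) /\ (c <= y0 n <= y1 n /\ y1 n <= d) /\
    x1 n - x0 n = (b - a) / 2 ^ n /\ y1 n - y0 n = (d - c) / 2 ^ n /\
    K / 4 ^ n <= Cmod (rect_int f (x0 n) (x1 n) (y0 n) (y1 n))).
  { induction n as [|n (I1 & I2 & I3 & I4 & I5)].
    - unfold x0, x1, y0, y1; simpl. fold K. repeat split; lra.
    - destruct (Q n) as (Q1 & Q2 & Q3); try lra.
      assert (P2 : 2 ^ n <> 0) by (apply pow_nonzero; lra).
      assert (P4 : 4 ^ n <> 0) by (apply pow_nonzero; lra).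
      split; [|split; [|split; [|split]]].
      + destruct Q1 as [[-> ->]|[-> ->]]; lra.
      + destruct Q2 as [[-> ->]|[-> ->]]; lra.
      + transitivity ((x1 n - x0 n) / 2). destruct Q1 as [[-> ->]|[-> ->]]; lra.
        rewrite I3. simpl. now field.
      + transitivity ((y1 n - y0 n) / 2). destruct Q2 as [[-> ->]|[-> ->]]; lra.
        rewrite I4. simpl. now field.
      + eapply Rle_trans; [|exact Q3]. replace (K / 4 ^ S n) with (K / 4 ^ n / 4). lra.
        simpl. now field. }
  intros n. destruct (J n) as (I1 & I2 & I3 & I4 & I5).
  destruct (Q n) as (Q1 & Q2 & Q3); try lra.
  repeat (split; [try assumption; lra|]).
  destruct Q1 as [[-> ->]|[-> ->]]; destruct Q2 as [[-> ->]|[-> ->]]; lra. }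
destruct (nested_point x0 x1) as [x Hx]; try (intros n; apply I).
destruct (nested_point y0 y1) as [y Hy]; try (intros n; apply I).
destruct (Hf (x, y)) as [l Hl].
{ specialize (Hx 0%nat). specialize (Hy 0%nat). unfold x0, x1, y0, y1 in Hx, Hy; simpl in Hx, Hy.
  split; simpl; rewrite between_le; lra. }
apply Cmod_eq_0. fold K. apply NNPP. intros HK.
assert (K0 : 0 < K) by (pose proof (Cmod_ge_0 (rect_int f a b c d)); fold K in H; lra).
set (L := (b - a) + (d - c)). assert (L0 : 0 <= L) by (unfold L; lra).
(* The final estimate reads [K <= 4 * eps * L ^ 2], which this [eps] contradicts; the [+ 1] covers a
   degenerate rectangle with [L = 0]. *)
destruct (Hl (K / (8 * L ^ 2 + 1))) as (r & Hr & Hw).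
{ apply Rdiv_lt_0_compat; nra. }
set (eps := K / (8 * L ^ 2 + 1)) in *.
assert (Heps : eps * (8 * L ^ 2 + 1) = K) by (unfold eps; field; nra).
assert (Heps0 : 0 < eps) by (apply Rdiv_lt_0_compat; nra).
assert (exists n, L / 2 ^ n < r) as [n Hn].
{ destruct (pow_lt_1_zero (/ 2)) with (y := r / (L + 1)) as [N HN].
  - rewrite Rabs_pos_eq; lra.
  - apply Rdiv_lt_0_compat; lra.
  - exists N. specialize (HN N (le_n N)). rewrite Rabs_pos_eq in HN by (apply pow_le; lra).
    rewrite pow_inv in HN. apply Rlt_div_r in HN; [|lra].
    assert (0 < / 2 ^ N) by (apply Rinv_0_lt_compat, pow_lt; lra). unfold Rdiv. nra. }
destruct (I n) as (I1 & I2 & I3 & I4 & I5 & _). specialize (Hx n). specialize (Hy n).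
assert (P2 : 0 < 2 ^ n) by (apply pow_lt; lra).
set (w := L / 2 ^ n) in *.
assert (Hw0 : w = (x1 n - x0 n) + (y1 n - y0 n)).
{ rewrite I3, I4. unfold w, L. field. lra. }
(* The affine part has a quadratic primitive and integrates to zero, so only the error [f - h], of
   size [eps * w], contributes. *)
set (h := fun z : C => (f (x, y) + l * (z - (x, y)))%C).
assert (Hch : forall z, ccont h z).
{ intros z. unfold h. apply ccont_plus. apply ccont_const. apply ccont_mult. apply ccont_const.
  apply ccont_plus. apply ccont_id. apply ccont_const. }
assert (Hcn : forall z, in_box (x0 n) (x1 n) (y0 n) (y1 n) z -> ccont f z).
{ intros z [Hz1 Hz2]. rewrite between_le in Hz1, Hz2 by lra. apply Hc.
  split; rewrite between_le; lra. }
assert (Zh : rect_int h (x0 n) (x1 n) (y0 n) (y1 n) = 0).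
{ apply (rect_int_exact (fun z => f (x, y) * z + l / RtoC 2 * ((z - (x, y)) * (z - (x, y))))%C).
  - intros z _. apply Hch.
  - intros z _. unfold h. eapply cdiff_eq_val.
    + apply cdiff_plus. apply cdiff_scal, cdiff_id. apply cdiff_scal.
      apply (cdiff_mult (fun z => z - (x, y))%C (fun z => z - (x, y))%C);
      (apply cdiff_minus; [apply cdiff_id|apply cdiff_const]).
    + simpl. field. }
assert (B := rect_int_bound (fun z => f z - h z)%C (x0 n) (x1 n) (y0 n) (y1 n) (eps * w)).
rewrite rect_int_minus, Zh in B by (try assumption; intros; apply Hch).
replace (rect_int f (x0 n) (x1 n) (y0 n) (y1 n) - 0)%C
  with (rect_int f (x0 n) (x1 n) (y0 n) (y1 n)) in B by ring.
assert (B' : Cmod (rect_int f (x0 n) (x1 n) (y0 n) (y1 n)) <= 4 * (eps * w) * w).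
{ rewrite Hw0 at 2. rewrite <- (Rabs_pos_eq (x1 n - x0 n)) by lra.
  rewrite <- (Rabs_pos_eq (y1 n - y0 n)) by lra. apply B.
  - intros z Hz. apply ccont_plus. now apply Hcn.
    apply (ccont_local _ (fun z => - (1) * h z)%C _ 1). lra. intros; ring.
    apply ccont_mult. apply ccont_const. apply Hch.
  - intros z [Hz1 Hz2]. rewrite between_le in Hz1, Hz2 by lra.
    assert (D : Cmod (z - (x, y)) <= w).
    { eapply Rle_trans. apply Cmod_le_sum. simpl. rewrite Hw0.
      apply Rplus_le_compat; apply Rabs_le; lra. }
    unfold h. replace (f z - (f (x, y) + l * (z - (x, y))))%C
      with (f z - f (x, y) - l * (z - (x, y)))%C by ring.
    eapply Rle_trans. apply Hw. lra. apply Rmult_le_compat_l; lra. }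
assert (E4 : 4 ^ n = 2 ^ n * 2 ^ n) by (rewrite <- Rpow_mult_distr; f_equal; lra).
assert (Fin : K / 4 ^ n <= 4 * (eps * w) * w) by lra.
assert (P4 : 0 < 4 ^ n) by (apply pow_lt; lra).
apply (Rmult_le_compat_r (4 ^ n)) in Fin; [|lra].
replace (K / 4 ^ n * 4 ^ n) with K in Fin by (field; lra).
assert (4 * (eps * w) * w * 4 ^ n = 4 * eps * L ^ 2).
{ rewrite E4. unfold w. field. lra. }
assert (0 <= L ^ 2) by nra. nra.
Qed.

Lemma goursat (f : C -> C) (a b c d : R) :
  (forall z, in_box a b c d z -> exists l, cdiff f z l) ->
  rect_int f a b c d = 0.
Proof.
intros Hf.
assert (W : forall a b c d, (forall z, in_box a b c d z -> exists l, cdiff f z l) ->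
  forall z, in_box a b c d z -> ccont f z).
{ intros a' b' c' d' H z Hz. destruct (H z Hz) as [l Hl]. now apply cdiff_ccont in Hl. }
assert (S : forall a b c d, c <= d -> (forall z, in_box a b c d z -> exists l, cdiff f z l) ->
  rect_int f a b c d = 0).
{ intros a' b' c' d' L H. destruct (Rle_dec a' b') as [L'|L'].
  - now apply goursat_ordered.
  - assert (H' : forall z, in_box b' a' c' d' z -> exists l, cdiff f z l).
    { intros z [H1 H2]. apply H. split; [now apply between_comm|easy]. }
    rewrite rect_int_swap_x by now apply W. rewrite goursat_ordered by (try easy; lra). ring. }
destruct (Rle_dec c d) as [L|L].
- now apply S.
- assert (H' : forall z, in_box a b d c z -> exists l, cdiff f z l).
  { intros z [H1 H2]. apply Hf. split; [easy|now apply between_comm]. }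
  rewrite rect_int_swap_y by now apply W. rewrite S by (try easy; lra). ring.
Qed.

(** * Primitives on squares *)

Definition in_square (p : C) (r : R) (z : C) : Prop :=
  Rabs (fst z - fst p) < r /\ Rabs (snd z - snd p) < r.

Lemma in_square_open (p : C) (r : R) (z : C) : in_square p r z ->
  exists d, 0 < d /\ forall w, Cmod (w - z) < d -> in_square p r w.
Proof.
intros [H1 H2]. exists (Rmin (r - Rabs (fst z - fst p)) (r - Rabs (snd z - snd p))).
split. apply Rmin_pos; lra. intros w Hw.
assert (Hw1 := Rlt_le_trans _ _ _ Hw (Rmin_l _ _)).
assert (Hw2 := Rlt_le_trans _ _ _ Hw (Rmin_r _ _)).
assert (T1 := Cmod_fst (w - z)). assert (T2 := Cmod_snd (w - z)). simpl in T1, T2.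
split.
- pose proof (Rabs_triang (fst w + - fst z) (fst z - fst p)).
  replace (fst w + - fst z + (fst z - fst p)) with (fst w - fst p) in H by ring. lra.
- pose proof (Rabs_triang (snd w + - snd z) (snd z - snd p)).
  replace (snd w + - snd z + (snd z - snd p)) with (snd w - snd p) in H by ring. lra.
Qed.

(** The primitive integrates from the centre first horizontally, then vertically; a square contains
    such a path to each of its points, together with the rectangles to which Goursat's theorem is
    applied. *)
Lemma square_primitive (f : C -> C) (p : C) (r : R) :
  (forall z, in_square p r z -> exists l, cdiff f z l) ->
  exists F, forall z, in_square p r z -> cdiff F z (f z).
Proof.
intros Hf.
assert (Hc : forall z, in_square p r z -> ccont f z).
{ intros z Hz. destruct (Hf z Hz) as [l Hl]. now apply cdiff_ccont in Hl. }
set (F := fun z : C => (CI (fun s => f (s, snd p)) (fst p) (fst z)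
  + Ci * CI (fun t => f (fst z, t)) (snd p) (snd z))%C).
exists F. intros z Hz.
assert (Hr : 0 < r) by (destruct Hz; pose proof (Rabs_pos (fst z - fst p)); lra).
assert (Rpp : forall x, Rabs (x - x) < r) by (intros x; rewrite Rminus_diag, Rabs_R0; lra).
(* Goursat on the rectangle between heights [snd p] and [snd z] moves the horizontal part up to the
   height of [z], so the increment of [F] becomes an integral along a short path from [z] to [w]. *)
assert (Hdiff : forall w, in_square p r w ->
  (F w - F z = CI (fun s => f (s, snd z)) (fst z) (fst w)
   + Ci * CI (fun t => f (fst w, t)) (snd z) (snd w))%C).
{ intros w Hw. destruct Hz as [Hz1 Hz2], Hw as [Hw1 Hw2].
  assert (Gz := goursat f (fst z) (fst w) (snd p) (snd z)).
  unfold rect_int in Gz. unfold F.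
  rewrite <- (CI_Chasles (fun s => f (s, snd p)) (fst p) (fst z) (fst w)).
  rewrite <- (CI_Chasles (fun s => f (fst w, s)) (snd p) (snd z) (snd w)).
  set (A1 := CI (fun s => f (s, snd p)) (fst p) (fst z)) in *.
  set (A2 := CI (fun s => f (s, snd p)) (fst z) (fst w)) in *.
  set (A3 := CI (fun t => f (fst w, t)) (snd p) (snd z)) in *.
  set (A4 := CI (fun t => f (fst w, t)) (snd z) (snd w)) in *.
  set (A5 := CI (fun t => f (fst z, t)) (snd p) (snd z)) in *.
  set (A6 := CI (fun s => f (s, snd z)) (fst z) (fst w)) in *.
  transitivity (A6 + Ci * A4 + (A2 + Ci * A3 - A6 - Ci * A5))%C. ring. rewrite Gz. ring.
  - intros x [Hx1 Hx2]. apply Hf. split.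
    eapply between_abs; eauto. eapply between_abs; eauto.
  - intros t Ht. apply pcont_vertical, Hc. split; simpl; [easy|eapply between_abs; eauto].
  - intros t Ht. apply pcont_vertical, Hc. split; simpl; [easy|eapply between_abs; eauto].
  - intros t Ht. apply pcont_horizontal, Hc. split; simpl; [eapply between_abs; eauto|easy].
  - intros t Ht. apply pcont_horizontal, Hc. split; simpl; [eapply between_abs; eauto|easy]. }
intros eps He.
(* The short path stays within [2 * Cmod (w - z)] of [z], hence [d / 2] below. Each of its two legs
   costs the factor 2 of [CI_bound], hence [eps / 4]. *)
destruct (Hc z Hz (eps / 4)) as (d & Hd & Hw). lra.
destruct (in_square_open p r z Hz) as (d' & Hd' & Hw').
exists (Rmin (d / 2) d'). split. apply Rmin_pos; lra. intros w Hb.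
assert (Hb1 := Rlt_le_trans _ _ _ Hb (Rmin_l _ _)).
assert (Hb2 := Hw' w (Rlt_le_trans _ _ _ Hb (Rmin_r _ _))).
rewrite (Hdiff w Hb2).
assert (T1 := Cmod_fst (w - z)). assert (T2 := Cmod_snd (w - z)). simpl in T1, T2.
assert (Hcx : forall s, between (fst z) (fst w) s -> pcont (fun s => f (s, snd z)) s).
{ intros s Hs. apply pcont_horizontal, Hc. destruct Hz, Hb2.
  split; simpl; [eapply between_abs; eauto|easy]. }
assert (Hcy : forall s, between (snd z) (snd w) s -> pcont (fun s => f (fst w, s)) s).
{ intros s Hs. apply pcont_vertical, Hc. destruct Hz, Hb2.
  split; simpl; [easy|eapply between_abs; eauto]. }
replace (CI (fun s => f (s, snd z)) (fst z) (fst w)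
  + Ci * CI (fun t => f (fst w, t)) (snd z) (snd w) - f z * (w - z))%C with
  (CI (fun s => f (s, snd z) - f z)%C (fst z) (fst w)
   + Ci * CI (fun t => f (fst w, t) - f z)%C (snd z) (snd w))%C.
2:{ rewrite !CI_minus by (try assumption; intros; apply pcont_const). rewrite !CI_const.
  replace (w - z)%C with (RtoC (fst w - fst z) + Ci * RtoC (snd w - snd z))%C
    by (unfold Ci, RtoC, Cminus, Cplus, Cmult, Copp; simpl; f_equal; ring).
  ring. }
assert (B1 : Cmod (CI (fun s => f (s, snd z) - f z)%C (fst z) (fst w)) <=
  2 * (eps / 4) * Rabs (fst w - fst z)).
{ apply CI_bound.
  - intros t Ht. apply pcont_plus. now apply Hcx. apply pcont_const.
  - intros t Ht. apply Rlt_le, Hw. eapply Rle_lt_trans. apply Cmod_le_sum. simpl.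
    apply between_dist in Ht. rewrite Rplus_opp_r, Rabs_R0.
    unfold Rminus in Ht. pose proof (Rabs_pos (fst w + - fst z)). lra. }
assert (B2 : Cmod (CI (fun s => f (fst w, s) - f z)%C (snd z) (snd w)) <=
  2 * (eps / 4) * Rabs (snd w - snd z)).
{ apply CI_bound.
  - intros t Ht. apply pcont_plus. now apply Hcy. apply pcont_const.
  - intros t Ht. apply Rlt_le, Hw. eapply Rle_lt_trans. apply Cmod_le_sum. simpl.
    apply between_dist in Ht. unfold Rminus in Ht. lra. }
eapply Rle_trans. apply Cmod_triangle. rewrite Cmod_mult, Cmod_Ci, Rmult_1_l.
unfold Rminus in *. nra.
Qed.

(** * Cauchy's formula *)

Definition cis (t : R) : C := (cos t, sin t).

Lemma pder_cis (t : R) : pder cis t (Ci * cis t).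
Proof.
split; simpl; apply is_derive_Reals.
- replace (0 * cos t - 1 * sin t) with (- sin t) by ring. apply derivable_pt_lim_cos.
- replace (0 * sin t + 1 * cos t) with (cos t) by ring. apply derivable_pt_lim_sin.
Qed.

Lemma Cmod_cis (t : R) : Cmod (cis t) = 1.
Proof.
unfold Cmod, cis; simpl. transitivity (sqrt 1); [f_equal|apply sqrt_1].
pose proof (sin2_cos2 t) as H. unfold Rsqr in H. lra.
Qed.

Definition circle (c : C) (r t : R) : C := (c + RtoC r * cis t)%C.

Lemma pder_circle (c : C) (r t : R) : pder (circle c r) t (RtoC r * Ci * cis t).
Proof.
eapply pder_eq_val. apply (pder_comp (fun z => c + RtoC r * z)%C cis). apply pder_cis.
apply cdiff_plus. apply cdiff_const. apply cdiff_scal, cdiff_id. ring.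
Qed.

Lemma Cmod_circle (c : C) (r t : R) : 0 <= r -> Cmod (circle c r t - c) = r.
Proof.
intros Hr. unfold circle. replace (c + RtoC r * cis t - c)%C with (RtoC r * cis t)%C by ring.
rewrite Cmod_mult, Cmod_cis, Cmod_R, Rabs_pos_eq; lra.
Qed.

(** Differentiation under the integral sign: the bound on the second derivative is uniform in [t],
    so [taylor2] makes the remainder of the integrand at most [B * Cmod (w - a) ^ 2] for all [t] at
    once. *)
Lemma CI_diff_param (k k1 k2 : R -> C -> C) (a : C) (d B u v : R) :
  0 < d ->
  (forall t w, Cmod (w - a) < d -> cdiff (k t) w (k1 t w)) ->
  (forall t w, Cmod (w - a) < d -> cdiff (k1 t) w (k2 t w)) ->
  (forall t w, between u v t -> Cmod (w - a) < d -> Cmod (k2 t w) <= B) ->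
  (forall t w, Cmod (w - a) < d -> pcont (fun s => k s w) t) ->
  (forall t, pcont (fun s => k1 s a) t) ->
  cdiff (fun w => CI (fun t => k t w) u v) a (CI (fun t => k1 t a) u v).
Proof.
intros Hd H1 H2 HB Hc Hc1 eps He.
assert (HB0 : 0 <= B).
{ eapply Rle_trans; [apply Cmod_ge_0|apply (HB u a)]. apply between_l.
  rewrite Cmod_sub_self. lra. }
set (D := 2 * B * Rabs (v - u) + 1).
assert (HD : 0 < D).
{ unfold D. assert (0 <= 2 * B * Rabs (v - u)). apply Rmult_le_pos. lra. apply Rabs_pos. lra. }
exists (Rmin d (eps / D)). split. apply Rmin_pos. lra. now apply Rdiv_lt_0_compat.
intros w Hw. assert (Hw1 := Rlt_le_trans _ _ _ Hw (Rmin_l _ _)).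
assert (Hw2 := Rlt_le_trans _ _ _ Hw (Rmin_r _ _)). apply Rlt_div_r in Hw2; [|easy].
assert (Ha : Cmod (a - a) < d) by (rewrite Cmod_sub_self; lra).
assert (Hk : forall t, between u v t -> pcont (fun s => k s w - k s a)%C t).
{ intros t _. apply pcont_plus. now apply Hc.
  apply (pcont_comp (fun z => - z)%C (fun s => k s a)). now apply Hc.
  eapply cdiff_ccont. apply (cdiff_opp (fun z => z)), cdiff_id. }
assert (Hk1 : forall t, between u v t -> pcont (fun s => (w - a) * k1 s a)%C t).
{ intros t _. apply pcont_mult. apply pcont_const. apply Hc1. }
rewrite <- CI_minus by (intros; now apply Hc).
rewrite (Cmult_comm _ (w - a)), <- CI_scal by (intros; apply Hc1).
rewrite <- CI_minus by assumption.
eapply Rle_trans. apply (CI_bound _ _ _ (B * Cmod (w - a) ^ 2)).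
- intros t Ht. apply pcont_plus. now apply Hk.
  apply (pcont_comp (fun z => - z)%C (fun s => (w - a) * k1 s a)%C). now apply Hk1.
  eapply cdiff_ccont. apply (cdiff_opp (fun z => z)), cdiff_id.
- intros t Ht. rewrite (Cmult_comm (w - a)).
  apply (taylor2 (k t) (k1 t) (k2 t)); intros x Hx.
  apply H1; lra. apply H2; lra. apply HB; [easy|lra].
- pose proof (Cmod_ge_0 (w - a)). set (m := Cmod (w - a)) in *.
  replace (2 * (B * m ^ 2) * Rabs (v - u)) with ((D - 1) * m * m) by (unfold D; ring).
  apply Rmult_le_compat_r; [easy|]. nra.
Qed.

Lemma cdiff_inv_pow (p w : C) (n : nat) : p <> w ->
  cdiff (fun z => Cpow (/ (p - z)) n) w (RtoC (INR n) * Cpow (/ (p - w)) (S n)).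
Proof.
intros Hn. assert (H0 := Cminus_eq_contra _ _ Hn).
assert (H1 : cdiff (fun z => / (p - z))%C w (/ (p - w) * / (p - w))).
{ eapply cdiff_eq_val. apply (cdiff_inv (fun z => p - z)%C).
  apply cdiff_minus. apply cdiff_const. apply cdiff_id. easy. field. easy. }
induction n as [|n IH].
- simpl. apply (cdiff_eq_val _ _ 0). apply cdiff_const. ring.
- simpl Cpow at 1. eapply cdiff_eq_val.
  + apply (cdiff_mult (fun z => / (p - z))%C (fun z => Cpow (/ (p - z)) n)). exact H1. exact IH.
  + rewrite S_INR, RtoC_plus. simpl. ring.
Qed.

Lemma pcont_bounded (g : R -> C) (a b : R) : a <= b -> (forall t, pcont g t) ->
  exists B, forall t, a <= t <= b -> Cmod (g t) <= B.
Proof.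
intros Hab Hg. destruct (continuity_ab_maj (fun t => Cmod (g t)) a b Hab) as (x & Hx & _).
- intros t _. apply continuity_pt_filterlim.
  assert (H := Hg t). rewrite pcont_eps in H. intros P [e He].
  destruct (H e (cond_pos e)) as (d & Hd & Hs). exists (mkposreal d Hd). intros s Hb.
  apply He. specialize (Hs s Hb).
  change (Rabs (Cmod (g s) - Cmod (g t)) < e). apply Rabs_lt_between.
  pose proof (Cmod_le_add_sub (g s) (g t)). pose proof (Cmod_le_add_sub (g t) (g s)).
  rewrite (Cmod_sub_sym (g t)) in H1. lra.
- now exists (Cmod (g x)).
Qed.

(** A Cauchy integral with density [phi t dt] in place of [F(z) dz]. The free exponent closes the
    family under differentiation: the derivative for [n] is [n] times the transform for [S n]. *)
Definition cauchy_transform (c : C) (r : R) (phi : R -> C) (n : nat) (a : C) : C :=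
  CI (fun t => phi t * Cpow (/ (circle c r t - a)) n)%C 0 (2 * PI).

Section circle.
Variables (c : C) (r : R).
Hypothesis Hr : 0 < r.

Lemma circle_neq (a : C) (t : R) : Cmod (a - c) < r -> circle c r t <> a.
Proof. intros Ha E. pose proof (Cmod_circle c r t). rewrite E in H. lra. Qed.

Lemma circle_far (a w : C) (t : R) :
  Cmod (w - a) < (r - Cmod (a - c)) / 2 -> (r - Cmod (a - c)) / 2 <= Cmod (circle c r t - w).
Proof.
intros Hw. pose proof (Cmod_circle c r t).
pose proof (Cmod_sub_triangle (circle c r t) w c).
pose proof (Cmod_sub_triangle w a c). lra.
Qed.

Lemma pcont_cauchy_kernel (phi : R -> C) (n : nat) (a : C) (t : R) :
  (forall s, pcont phi s) -> Cmod (a - c) < r ->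
  pcont (fun s => phi s * Cpow (/ (circle c r s - a)) n)%C t.
Proof.
intros Hp Ha. apply pcont_mult. apply Hp.
assert (H : pcont (fun s => / (circle c r s - a))%C t).
{ apply (pcont_comp (fun z => / (z - a))%C (circle c r)).
  eapply pder_pcont, pder_circle. eapply cdiff_ccont, cdiff_inv.
  apply cdiff_minus. apply cdiff_id. apply cdiff_const.
  apply Cminus_eq_contra. now apply circle_neq. }
induction n as [|n IH].
- apply pcont_const.
- simpl. now apply pcont_mult.
Qed.

Lemma cauchy_transform_cdiff (phi : R -> C) (n : nat) (a : C) :
  (forall s, pcont phi s) -> Cmod (a - c) < r ->
  cdiff (cauchy_transform c r phi n) a (RtoC (INR n) * cauchy_transform c r phi (S n) a).
Proof.
intros Hp Ha. pose proof PI_RGT_0.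
destruct (pcont_bounded phi 0 (2 * PI)) as [B HB]; [lra|easy|].
set (m := (r - Cmod (a - c)) / 2). assert (Hm : 0 < m) by (unfold m; lra).
assert (Hin : forall w, Cmod (w - a) < m -> Cmod (w - c) < r).
{ intros w Hw. pose proof (Cmod_sub_triangle w a c). unfold m in Hw. lra. }
unfold cauchy_transform at 2.
rewrite <- CI_scal by (intros; now apply pcont_cauchy_kernel).
set (q := fun t w => (/ (circle c r t - w))%C).
assert (Hq : forall t w, Cmod (w - a) < m -> forall j,
  cdiff (fun z => Cpow (q t z) j) w (RtoC (INR j) * Cpow (q t w) (S j))).
{ intros t w Hw j. apply cdiff_inv_pow, circle_neq. now apply Hin. }
apply (CI_diff_param (fun t w => phi t * Cpow (q t w) n)%C
  (fun t w => RtoC (INR n) * (phi t * Cpow (q t w) (S n)))%C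
  (fun t w => RtoC (INR n) * (phi t * (RtoC (INR (S n)) * Cpow (q t w) (S (S n)))))%C
  a m (INR n * (B * (INR (S n) * (/ m) ^ (S (S n)))))); try easy.
- intros t w Hw. eapply cdiff_eq_val. apply cdiff_scal. now apply Hq. ring.
- intros t w Hw. apply cdiff_scal, cdiff_scal. now apply Hq.
- intros t w Ht Hw. rewrite between_le in Ht by lra.
  rewrite !Cmod_mult, !Cmod_R, Cmod_pow, !(Rabs_pos_eq (INR _)) by apply pos_INR.
  apply Rmult_le_compat_l. apply pos_INR.
  apply Rmult_le_compat; [apply Cmod_ge_0| |now apply HB|].
  apply Rmult_le_pos. apply pos_INR. apply pow_le, Cmod_ge_0.
  apply Rmult_le_compat_l. apply pos_INR. apply pow_incr. split. apply Cmod_ge_0.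
  unfold q. rewrite Cmod_inv by (apply Cminus_eq_contra, circle_neq; now apply Hin).
  apply Rinv_le_contravar; [easy|]. now apply circle_far.
- intros t w Hw. apply pcont_cauchy_kernel; [easy|now apply Hin].
- intros t. apply pcont_mult. apply pcont_const. now apply pcont_cauchy_kernel.
Qed.

Lemma pcont_scaled_cis (t : R) : pcont (fun s => RtoC r * cis s)%C t.
Proof. apply pcont_mult. apply pcont_const. eapply pder_pcont, pder_cis. Qed.

(** The derivative in [a] is the transform of exponent 2, which vanishes because
    [/ (circle c r t - w)] is, up to a constant factor, a periodic primitive of its integrand. The
    value is thus the one at the centre, where the integrand is 1. *)
Lemma cauchy_transform_one (a : C) : Cmod (a - c) < r ->
  cauchy_transform c r (fun t => RtoC r * cis t)%C 1 a = RtoC (2 * PI).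
Proof.
intros Ha. set (phi := fun t => (RtoC r * cis t)%C).
assert (Hphi := pcont_scaled_cis). fold phi in Hphi.
assert (Z : forall w, Cmod (w - c) < r -> cauchy_transform c r phi 2 w = 0).
{ intros w Hw. 
  assert (E : (- Ci * cauchy_transform c r phi 2 w)%C = 0).
  { unfold cauchy_transform. rewrite <- CI_scal by (intros; now apply pcont_cauchy_kernel).
    rewrite (CI_derive (fun t => / (circle c r t - w))%C).
    - unfold circle, cis. rewrite cos_2PI, sin_2PI, cos_0, sin_0. ring.
    - intros t _. eapply pder_eq_val.
      + apply (pder_comp (fun z => / (z - w))%C (circle c r)). apply pder_circle.
        apply cdiff_inv. apply cdiff_minus. apply cdiff_id. apply cdiff_const.
        apply Cminus_eq_contra. now apply circle_neq.
      + unfold phi. simpl. field. apply Cminus_eq_contra. now apply circle_neq.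
    - intros t _. apply pcont_mult. apply pcont_const. now apply pcont_cauchy_kernel. }
  apply NNPP. intros H0. apply (Cmult_neq_0 (- Ci)) in H0; [easy|].
  intros E'. apply Ci_nz. replace Ci with (- (- Ci))%C by ring. rewrite E'. ring. }
transitivity (cauchy_transform c r phi 1 c).
- assert (T := mean_value_ineq (cauchy_transform c r phi 1) (fun _ => 0) c a 0).
  rewrite Rmult_0_l in T. apply Ceq_minus, Cmod_eq_0, Rle_antisym; [|apply Cmod_ge_0].
  apply T.
  + intros w Hw. eapply cdiff_eq_val. apply cauchy_transform_cdiff. easy. lra.
    rewrite Z by lra. ring.
  + intros w _. rewrite Cmod_0. lra.
- unfold cauchy_transform. rewrite (CI_ext _ (fun _ => 1)).
  + rewrite CI_const. replace (2 * PI - 0) with (2 * PI) by ring. ring.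
  + intros t _. unfold phi, circle. simpl.
    replace (c + RtoC r * cis t - c)%C with (RtoC r * cis t)%C by ring.
    field. assert (Cmod (RtoC r * cis t) = r).
    { rewrite Cmod_mult, Cmod_cis, Cmod_R, Rabs_pos_eq; lra. }
    split; intros E; rewrite E in H.
    rewrite Cmult_0_r, Cmod_0 in H; lra. rewrite Cmult_0_l, Cmod_0 in H; lra.
Qed.

End circle.

Lemma circle_in_square (c : C) (r s t : R) : 0 < r < s -> in_square c s (circle c r t).
Proof.
intros H. pose proof (Cmod_circle c r t).
pose proof (Cmod_fst (circle c r t - c)). pose proof (Cmod_snd (circle c r t - c)).
simpl in H1, H2. split; unfold Rminus; simpl; lra.
Qed.

Lemma ball_in_square (c z : C) (s : R) : Cmod (z - c) < s -> in_square c s z.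
Proof.
intros H. pose proof (Cmod_fst (z - c)). pose proof (Cmod_snd (z - c)).
simpl in H0, H1. split; unfold Rminus; lra.
Qed.

Lemma circle_integral_zero (g : C -> C) (c : C) (r s : R) : 0 < r < s ->
  (forall z, in_square c s z -> exists l, cdiff g z l) ->
  CI (fun t => g (circle c r t) * (RtoC r * cis t))%C 0 (2 * PI) = 0.
Proof.
intros Hr Hg. destruct (square_primitive g c s Hg) as [P HP].
assert (Hc : forall t, pcont (fun t => g (circle c r t) * (RtoC r * cis t))%C t).
{ intros t. apply pcont_mult; [|apply pcont_scaled_cis].
  apply pcont_comp. eapply pder_pcont, pder_circle.
  destruct (Hg (circle c r t)) as [l Hl]. now apply circle_in_square. now apply cdiff_ccont in Hl. }
assert (E : (Ci * CI (fun t => g (circle c r t) * (RtoC r * cis t)) 0 (2 * PI))%C = 0).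
{ rewrite <- CI_scal by (intros; apply Hc).
  rewrite (CI_derive (fun t => P (circle c r t))).
  - unfold circle, cis. rewrite cos_2PI, sin_2PI, cos_0, sin_0. ring.
  - intros t _. eapply pder_eq_val. apply pder_comp. apply pder_circle.
    apply HP. now apply circle_in_square. ring.
  - intros t _. apply pcont_mult. apply pcont_const. apply Hc. }
apply NNPP. intros H0. apply (Cmult_neq_0 Ci) in H0; [easy|]. apply Ci_nz.
Qed.

(* The difference quotient [slope F a (f a)] is differentiable at [a] because [F] has two
   derivatives, so Goursat applies to it with no exceptional point. *)
Lemma cauchy_formula (F f f1 : C -> C) (c a : C) (r s : R) : 0 < r < s -> Cmod (a - c) < r ->
  (forall z, in_square c s z -> cdiff F z (f z)) ->
  (forall z, in_square c s z -> cdiff f z (f1 z)) ->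
  cauchy_transform c r (fun t => F (circle c r t) * (RtoC r * cis t))%C 1 a
  = (RtoC (2 * PI) * F a)%C.
Proof.
intros Hr Ha HF Hf.
assert (Has : in_square c s a) by (apply ball_in_square; lra).
destruct (in_square_open c s a Has) as (d & Hd & Hball).
assert (Z := circle_integral_zero (slope F a (f a)) c r s Hr).
rewrite <- (cauchy_transform_one c r) with (a := a) by lra.
assert (Hphi : forall t, pcont (fun t => F (circle c r t) * (RtoC r * cis t))%C t).
{ intros t. apply pcont_mult; [|apply pcont_scaled_cis].
  apply pcont_comp. eapply pder_pcont, pder_circle.
  eapply cdiff_ccont, HF. now apply circle_in_square. }
assert (Hone : forall t, pcont (fun t => (RtoC r * cis t) * Cpow (/ (circle c r t - a)) 1)%C t).
{ intros t. apply pcont_cauchy_kernel; try lra. apply pcont_scaled_cis. }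
unfold cauchy_transform. rewrite (Cmult_comm (CI _ _ _)).
rewrite <- CI_scal by (intros; apply Hone).
apply Ceq_minus. rewrite <- CI_minus.
- rewrite <- Z.
  + apply CI_ext. intros t _. rewrite slope_neq by (apply circle_neq; lra).
    simpl. field. apply Cminus_eq_contra, circle_neq; lra.
  + intros z Hz. destruct (Ceq_dec z a) as [->|Hn].
    * eexists. eapply slope_cdiff_at. exact Hd. intros w Hw. now apply HF, Hball. now apply Hf.
    * eapply cdiff_slope_away. exact Hn. now apply HF.
- intros t _. apply pcont_cauchy_kernel; try lra. exact Hphi.
- intros t _. apply pcont_mult. apply pcont_const. apply Hone.
Qed.

(** Cauchy's formula is applied to a primitive [F] of [f], which has two derivatives [f] and [f1] by
    construction. So [F], [f] and [f1] are, up to constants, transforms of exponents 1, 2 and 3, and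
    the last is again differentiable. Continuity of [f1] is never assumed. *)
Theorem cdiff_derivative (f f1 : C -> C) (c : C) (rho : R) : 0 < rho ->
  (forall z, Cmod (z - c) < rho -> cdiff f z (f1 z)) ->
  exists l, cdiff f1 c l.
Proof.
intros Hrho Hf. set (s := rho / 2). set (r := rho / 4).
(* With [s = rho / 2] the square lies in the disk of radius [rho], because its points satisfy
   [|dx| + |dy| < 2 * s]; the circle of radius [r] lies inside the square. *)
assert (Hrs : 0 < r < s) by (unfold r, s; lra).
assert (Hsq : forall z, in_square c s z -> cdiff f z (f1 z)).
{ intros z [H1 H2]. apply Hf. eapply Rle_lt_trans. apply Cmod_le_sum.
  unfold Rminus, s in *. simpl. lra. }
destruct (square_primitive f c s) as [F HF].
{ intros z Hz. eexists. now apply Hsq. }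
set (phi := fun t => (F (circle c r t) * (RtoC r * cis t))%C).
assert (Hphi : forall t, pcont phi t).
{ intros t. apply pcont_mult; [|apply pcont_scaled_cis].
  apply pcont_comp. eapply pder_pcont, pder_circle.
  eapply cdiff_ccont, HF. now apply circle_in_square. }
assert (P0 : RtoC (2 * PI) <> 0).
{ intros E. apply RtoC_inj in E. pose proof PI_RGT_0. lra. }
set (k := (/ RtoC (2 * PI))%C).
assert (EF : forall a, Cmod (a - c) < r -> F a = (k * cauchy_transform c r phi 1 a)%C).
{ intros a Ha. unfold phi. rewrite (cauchy_formula F f f1 c a r s) by assumption.
  unfold k. field. easy. }
assert (Hlocal : forall g h l m, (forall a, Cmod (a - c) < r -> g a = h a) ->
  forall a, Cmod (a - c) < r -> cdiff g a l -> cdiff h a m -> l = m).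
{ intros g h l m E a Ha Hg Hh. apply (cdiff_unique g a); [easy|].
  apply (cdiff_local g h a m (r - Cmod (a - c))); [lra| |easy].
  intros w Hw. apply E. pose proof (Cmod_sub_triangle w a c). lra. }
assert (T : forall n a, Cmod (a - c) < r ->
  cdiff (cauchy_transform c r phi n) a (RtoC (INR n) * cauchy_transform c r phi (S n) a)).
{ intros n a Ha. apply cauchy_transform_cdiff; try easy; lra. }
assert (Ef : forall a, Cmod (a - c) < r -> f a = (k * cauchy_transform c r phi 2 a)%C).
{ intros a Ha. apply (Hlocal F _ _ _ EF a Ha).
  - apply HF, ball_in_square. lra.
  - eapply cdiff_eq_val. apply cdiff_scal, T, Ha. simpl. ring. }
assert (Ef1 : forall a, Cmod (a - c) < r -> f1 a = (k * (RtoC 2 * cauchy_transform c r phi 3 a))%C).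
{ intros a Ha. apply (Hlocal f _ _ _ Ef a Ha).
  - apply Hsq, ball_in_square. lra.
  - eapply cdiff_eq_val. apply cdiff_scal, T, Ha.
    replace (INR 2) with 2 by (simpl; ring). reflexivity. }
eexists. eapply (cdiff_local f1 _ c _ r). lra. exact Ef1.
apply cdiff_scal, cdiff_scal, T. rewrite Cmod_sub_self. lra.
Qed.

(** * The maximum modulus principle *)

Lemma R_cluster (u : nat -> R) (M : R) : (forall n, Rabs (u n) <= M) ->
  exists x, forall eps, 0 < eps -> forall N, exists n, (N <= n)%nat /\ Rabs (u n - x) < eps.
Proof.
intros H. destruct (Bolzano_Weierstrass u (fun x => - M <= x <= M)) as [x Hx].
- apply compact_P3.
- intros n. specialize (H n). apply Rabs_le_between in H. lra.
- exists x. intros eps He N.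
  destruct (Hx (disc x (mkposreal eps He)) N) as (n & Hn & Hd).
  + exists (mkposreal eps He). intros y Hy. exact Hy.
  + exists n. split; [easy|]. exact Hd.
Qed.

Lemma C_cluster (u : nat -> C) (M : R) : (forall n, Cmod (u n) <= M) ->
  exists p, forall eps, 0 < eps -> forall N, exists n, (N <= n)%nat /\ Cmod (u n - p) < eps.
Proof.
intros H. destruct (R_cluster (fun n => fst (u n)) M) as [x Hx].
{ intros n. eapply Rle_trans. apply Cmod_fst. apply H. }
(* Real parts are first made to converge along the indices [s k]; only then is a cluster value of
   the imaginary parts taken, along these same indices. *)
assert (Hch : forall k, exists n, (k <= n)%nat /\ Rabs (fst (u n) - x) < / (INR k + 1)).
{ intros k. apply Hx. apply Rinv_0_lt_compat. pose proof (pos_INR k). lra. }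
set (s := fun k => proj1_sig (constructive_indefinite_description _ (Hch k))).
assert (Hs : forall k, (k <= s k)%nat /\ Rabs (fst (u (s k)) - x) < / (INR k + 1)).
{ intros k. unfold s. now destruct constructive_indefinite_description. }
destruct (R_cluster (fun k => snd (u (s k))) M) as [y Hy].
{ intros n. eapply Rle_trans. apply Cmod_snd. apply H. }
exists (x, y). intros eps He N.
destruct (archimed_cor1 (eps / 2)) as (N0 & HN0 & HN1). lra.
destruct (Hy (eps / 2) ltac:(lra) (Nat.max N N0)) as (k & Hk & Hk').
exists (s k). destruct (Hs k) as [Hs1 Hs2]. split. lia.
eapply Rle_lt_trans. apply Cmod_le_sum. simpl.
assert (/ (INR k + 1) <= / INR N0).
{ apply Rinv_le_contravar. now apply lt_0_INR.
  assert (INR N0 <= INR k) by (apply le_INR; lia). lra. }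
unfold Rminus in *. lra.
Qed.

Definition ccont_real (g : C -> R) (z : C) : Prop :=
  forall eps, 0 < eps -> exists d, 0 < d /\
    forall w, Cmod (w - z) < d -> Rabs (g w - g z) < eps.

(** Every sequence in [S] has a cluster point in [S] at which the values of [g] accumulate too
    ([Hseq]). A sequence with [g (u n) > n] would contradict this, and a maximizing sequence then
    yields the point. *)
Lemma compact_max (S : C -> Prop) (g : C -> R) (M : R) (z0 : C) :
  S z0 -> (forall z, S z -> Cmod z <= M) ->
  (forall p, (forall eps, 0 < eps -> exists z, S z /\ Cmod (z - p) < eps) -> S p) ->
  (forall z, S z -> ccont_real g z) ->
  exists p, S p /\ forall z, S z -> g z <= g p.
Proof.
intros H0 HM Hcl Hg.
assert (Hseq : forall u : nat -> C, (forall n, S (u n)) -> exists p, S p /\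
  forall eps, 0 < eps -> forall N, exists n, (N <= n)%nat /\ Rabs (g (u n) - g p) < eps).
{ intros u Hu. destruct (C_cluster u M) as [p Hp]. { intros n. apply HM, Hu. }
  assert (Sp : S p).
  { apply Hcl. intros eps He. destruct (Hp eps He 0%nat) as (n & _ & Hn). now exists (u n). }
  exists p. split; [easy|]. intros eps He N. destruct (Hg p Sp eps He) as (d & Hd & Hw).
  destruct (Hp d Hd N) as (n & Hn & Hb). exists n. split; [easy|]. now apply Hw. }
assert (Hbd : exists B, forall z, S z -> g z <= B).
{ apply NNPP. intros Hn.
  assert (Hx : forall n : nat, exists z, S z /\ INR n < g z).
  { intros n. apply NNPP. intros Hn'. apply Hn. exists (INR n). intros z Hz.
    apply Rnot_lt_le. intros Hlt. apply Hn'. now exists z. }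
  set (u := fun n => proj1_sig (constructive_indefinite_description _ (Hx n))).
  assert (Hu : forall n, S (u n) /\ INR n < g (u n)).
  { intros n. unfold u. now destruct constructive_indefinite_description. }
  destruct (Hseq u) as (p & Sp & Hp). apply Hu.
  destruct (INR_unbounded (g p + 1)) as [N HN].
  destruct (Hp 1 Rlt_0_1 N) as (n & Hn1 & Hn2). destruct (Hu n) as [_ Hun].
  assert (INR N <= INR n) by now apply le_INR. apply Rabs_lt_between in Hn2. lra. }
destruct Hbd as [B HB].
destruct (completeness (fun y => exists z, S z /\ y = g z)) as [s [Hs1 Hs2]].
{ exists B. intros y (z & Hz & ->). now apply HB. } { now exists (g z0), z0. }
assert (Hx : forall n : nat, exists z, S z /\ s - / (INR n + 1) < g z).
{ intros n. apply NNPP. intros Hn'.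
  assert (0 < / (INR n + 1)) by (apply Rinv_0_lt_compat; pose proof (pos_INR n); lra).
  assert (s <= s - / (INR n + 1)); [|lra].
  apply Hs2. intros y (z & Hz & ->). apply Rnot_lt_le. intros Hlt. apply Hn'. now exists z. }
set (u := fun n => proj1_sig (constructive_indefinite_description _ (Hx n))).
assert (Hu : forall n, S (u n) /\ s - / (INR n + 1) < g (u n)).
{ intros n. unfold u. now destruct constructive_indefinite_description. }
destruct (Hseq u) as (p & Sp & Hp). apply Hu.
exists p. split; [easy|]. intros z Hz. apply Rle_trans with s. apply Hs1. now exists z.
apply le_epsilon. intros eps He.
destruct (archimed_cor1 (eps / 2)) as (N0 & HN0 & HN1). lra.
destruct (Hp (eps / 2) ltac:(lra) N0) as (n & Hn1 & Hn2). destruct (Hu n) as [_ Hun].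
assert (/ (INR n + 1) <= / INR N0).
{ apply Rinv_le_contravar. now apply lt_0_INR.
  assert (INR N0 <= INR n) by (apply le_INR; lia). lra. }
apply Rabs_lt_between in Hn2. lra.
Qed.

Definition dot (u v : C) : R := fst u * fst v + snd u * snd v.

Lemma dot_self (u : C) : dot u u = Cmod u ^ 2.
Proof. rewrite Cmod_sqr. unfold dot. ring. Qed.

Lemma pder_dot (g h : R -> C) (t : R) (l m : C) : pder g t l -> pder h t m ->
  derivable_pt_lim (fun s => dot (g s) (h s)) t (dot l (h t) + dot (g t) m).
Proof.
intros [G1 G2] [H1 H2]. rewrite !is_derive_Reals in *.
assert (E := derivable_pt_lim_plus _ _ _ _ _
  (derivable_pt_lim_mult _ _ _ _ _ G1 H1) (derivable_pt_lim_mult _ _ _ _ _ G2 H2)).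
unfold dot.
replace (fst l * fst (h t) + snd l * snd (h t) + (fst (g t) * fst m + snd (g t) * snd m))
  with (fst l * fst (h t) + fst (g t) * fst m + (snd l * snd (h t) + snd (g t) * snd m)) by ring.
exact E.
Qed.

(** The first derivative vanishes at 0; were [phi2] positive, it would be positive just to the right
    of 0 and the mean value theorem would lift [phi] above [phi 0]. *)
Lemma second_derivative_max (phi phi1 : R -> R) (phi2 d : R) : 0 < d ->
  (forall t, Rabs t < d -> derivable_pt_lim phi t (phi1 t)) ->
  derivable_pt_lim phi1 0 phi2 ->
  (forall t, Rabs t < d -> phi t <= phi 0) -> phi2 <= 0.
Proof.
intros Hd H1 H2 Hmax. apply Rnot_lt_le. intros Hpos.
assert (R0 : Rabs 0 < d) by (rewrite Rabs_R0; lra).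
assert (Z : phi1 0 = 0).
{ assert (pr : derivable_pt phi 0) by (exists (phi1 0); now apply H1).
  rewrite <- (derive_pt_eq_0 phi 0 (phi1 0) pr (H1 0 R0)).
  apply (deriv_maximum phi (- d) d 0 pr); try lra.
  intros x Hx1 Hx2. apply Hmax. apply Rabs_lt_between. lra. }
rewrite <- is_derive_Reals, is_derive_eps in H2.
destruct (H2 (phi2 / 2)) as (d' & Hd' & Hs). lra.
set (t := Rmin d d' / 2). assert (0 < Rmin d d') by now apply Rmin_pos.
pose proof (Rmin_l d d'). pose proof (Rmin_r d d').
destruct (MVT_cor2 phi phi1 0 t) as (s & Es & Hst). unfold t; lra.
{ intros s Hs'. apply H1. rewrite Rabs_pos_eq; unfold t in Hs'; lra. }
specialize (Hs s). rewrite Z, !Rminus_0_r, Rabs_pos_eq in Hs by lra.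
specialize (Hs ltac:(unfold t in Hst; lra)). apply Rabs_le_between in Hs.
assert (phi t <= phi 0) by (apply Hmax; rewrite Rabs_pos_eq; unfold t; lra).
assert (0 < phi1 s * (t - 0)) by (apply Rmult_lt_0_compat; nra). lra.
Qed.

(* At an interior maximum of [|h|^2 + eps |z - c|^2] the Laplacian, which is
   [4 |h'|^2 + 4 eps > 0], would have to be nonpositive. *)
Lemma max_modulus (h h1 : C -> C) (c : C) (rho M : R) : 0 < rho ->
  (forall z, Cmod (z - c) <= rho -> cdiff h z (h1 z)) ->
  (forall z, Cmod (z - c) = rho -> Cmod (h z) <= M) ->
  forall z, Cmod (z - c) <= rho -> Cmod (h z) <= M.
Proof.
intros Hrho Hh HM z0 Hz0. apply Rnot_lt_le. intros Hlt.
assert (M0 : 0 <= M).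
{ eapply Rle_trans; [apply Cmod_ge_0|apply (HM (c + RtoC rho)%C)].
  replace (c + RtoC rho - c)%C with (RtoC rho) by ring. rewrite Cmod_R, Rabs_pos_eq; lra. }
(* Then [eps * rho ^ 2] is half the gap between [|h z0|^2] and [M^2]: too little for the perturbed
   function to have its maximum on the boundary circle. *)
set (eps := (Cmod (h z0) ^ 2 - M ^ 2) / (2 * rho ^ 2)).
assert (Hgap : 0 < Cmod (h z0) ^ 2 - M ^ 2) by nra.
assert (Heps : 0 < eps) by (apply Rdiv_lt_0_compat; nra).
assert (Heps2 : eps * rho ^ 2 < Cmod (h z0) ^ 2 - M ^ 2).
{ replace (eps * rho ^ 2) with ((Cmod (h z0) ^ 2 - M ^ 2) / 2). lra.
  unfold eps. field. lra. }
set (u := fun z => dot (h z) (h z) + eps * dot (z - c)%C (z - c)%C).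
destruct (compact_max (fun z => Cmod (z - c) <= rho) u (Cmod c + rho) z0) as (p & Hp & Hmax).
- easy.
- intros z Hz. pose proof (Cmod_le_add_sub z c). lra.
- intros p Hp. apply le_epsilon. intros e He. destruct (Hp e He) as (z & Hz & Hzp).
  pose proof (Cmod_sub_triangle p z c). rewrite (Cmod_sub_sym p z) in H. lra.
- intros z Hz.
  assert (Cr : forall k : C -> C, ccont k z -> ccont_real (fun w => dot (k w) (k w)) z).
  { intros k Hk e He. 
    assert (Hm := ccont_mult k (fun w => Cconj (k w)) z Hk).
    destruct (Hm) with (eps := e) as (d & Hd & Hw); [|easy|].
    - intros e' He'. destruct (Hk e' He') as (d & Hd & Hw). exists d. split; [easy|].
      intros w Hb. rewrite <- Cminus_conj, Cmod_conj. now apply Hw.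
    - exists d. split; [easy|]. intros w Hb. eapply Rle_lt_trans; [|apply (Hw w Hb)].
      rewrite <- !Cmod2_conj. rewrite <- RtoC_minus, Cmod_R.
      rewrite !dot_self. lra. }
  assert (C1 := Cr h (cdiff_ccont _ _ _ (Hh z Hz))).
  assert (C2 := Cr (fun w => w - c)%C (cdiff_ccont _ _ _
    (cdiff_minus _ _ _ _ _ (cdiff_id z) (cdiff_const c z)))).
  intros e He. destruct (C1 (e / 2)) as (d1 & Hd1 & Hw1). lra.
  destruct (C2 (e / (2 * eps))) as (d2 & Hd2 & Hw2). apply Rdiv_lt_0_compat; lra.
  exists (Rmin d1 d2). split. now apply Rmin_pos. intros w Hw.
  specialize (Hw1 w (Rlt_le_trans _ _ _ Hw (Rmin_l _ _))).
  specialize (Hw2 w (Rlt_le_trans _ _ _ Hw (Rmin_r _ _))).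
  unfold u. apply Rlt_div_r in Hw2; [|lra].
  replace (dot (h w) (h w) + eps * dot (w - c) (w - c) - (dot (h z) (h z) + eps * dot (z - c) (z - c)))
    with ((dot (h w) (h w) - dot (h z) (h z)) + eps * (dot (w - c) (w - c) - dot (z - c) (z - c))) by ring.
  eapply Rle_lt_trans. apply Rabs_triang. rewrite Rabs_mult, (Rabs_pos_eq eps) by lra. lra.
- assert (Hin : Cmod (p - c) < rho).
  { destruct Hp as [Hp|Hp]; [easy|]. exfalso.
    specialize (Hmax z0 Hz0). unfold u in Hmax. rewrite !dot_self in Hmax.
    assert (Cmod (h p) <= M) by now apply HM. pose proof (Cmod_ge_0 (h p)).
    rewrite Hp in Hmax. assert (0 <= eps * Cmod (z0 - c) ^ 2) by (apply Rmult_le_pos; nra). nra. }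
  set (d := rho - Cmod (p - c)). assert (Hd : 0 < d) by (unfold d; lra).
  assert (Hb : forall z, Cmod (z - p) < d -> Cmod (z - c) <= rho).
  { intros z Hz. pose proof (Cmod_sub_triangle z p c). unfold d in Hz. lra. }
  destruct (cdiff_derivative h h1 p d Hd) as [l Hl].
  { intros z Hz. now apply Hh, Hb. }
  (* Half the second derivative in direction [v]. Adding the cases [v = 1] and [v = Ci] gives the
     Laplacian up to a factor, and the terms with [l * v * v] cancel. *)
  assert (T : forall v : C, Cmod v = 1 ->
    dot (h1 p * v) (h1 p * v) + dot (h p) (l * v * v) + eps <= 0).
  { intros v Hv.
    set (q := fun t => (p + RtoC t * v)%C).
    assert (q0 : q 0 = p) by (unfold q; ring).
    assert (Hq : forall t, Rabs t < d -> Cmod (q t - p) < d).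
    { intros t Ht. unfold q. replace (p + RtoC t * v - p)%C with (RtoC t * v)%C by ring.
      rewrite Cmod_mult, Cmod_R, Hv. lra. }
    assert (D0 : forall t, pder (fun s => q s - c)%C t v).
    { intros t. eapply pder_eq_val. apply (pder_comp (fun z => z - c)%C q). apply pder_line.
      apply cdiff_minus. apply cdiff_id. apply cdiff_const. ring. }
    assert (D1 : forall t, Rabs t < d -> pder (fun s => h (q s)) t (h1 (q t) * v)).
    { intros t Ht. apply (pder_comp h q). apply pder_line. apply Hh. now apply Hb, Hq. }
    assert (D2 : pder (fun s => h1 (q s) * v)%C 0 (l * v * v)).
    { eapply pder_eq_val. apply (pder_comp (fun z => h1 z * v)%C q). apply pder_line.
      rewrite q0. apply (cdiff_mult h1 (fun _ => v)). exact Hl. apply cdiff_const. ring. }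
    assert (S := second_derivative_max
      (fun t => dot (h (q t)) (h (q t)) + eps * dot (q t - c) (q t - c))
      (fun t => 2 * dot (h (q t)) (h1 (q t) * v) + 2 * eps * dot (q t - c) v)
      (2 * (dot (h1 p * v) (h1 p * v) + dot (h p) (l * v * v)) + 2 * eps * dot v v) d Hd).
    rewrite (dot_self v), Hv in S.
    assert (S' : 2 * (dot (h1 p * v) (h1 p * v) + dot (h p) (l * v * v)) + 2 * eps * 1 ^ 2 <= 0); [|lra].
    apply S.
    - intros t Ht.
      replace (2 * dot (h (q t)) (h1 (q t) * v) + 2 * eps * dot (q t - c) v) with
        (dot (h1 (q t) * v) (h (q t)) + dot (h (q t)) (h1 (q t) * v)
         + eps * (dot v (q t - c) + dot (q t - c) v)) by (unfold dot; ring).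
      apply derivable_pt_lim_plus. apply pder_dot; now apply D1.
      apply derivable_pt_lim_scal. apply (pder_dot (fun s => q s - c)%C (fun s => q s - c)%C); apply D0.
    - replace (2 * (dot (h1 p * v) (h1 p * v) + dot (h p) (l * v * v)) + 2 * eps * 1 ^ 2) with
        (2 * (dot (h1 (q 0%R) * v) (h1 (q 0%R) * v) + dot (h (q 0%R)) (l * v * v))
         + 2 * eps * (dot v v + dot (q 0%R - c) 0)).
      2:{ rewrite q0, (dot_self v), Hv. unfold dot. simpl. ring. }
      apply derivable_pt_lim_plus; apply derivable_pt_lim_scal.
      + apply (pder_dot (fun s => h (q s)) (fun s => h1 (q s) * v)%C). apply D1. rewrite Rabs_R0; lra. exact D2.
      + apply (pder_dot (fun s => q s - c)%C (fun _ => v)). apply D0.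
        split; simpl; apply (is_derive_const (V := R_NormedModule)).
    - intros t Ht. rewrite q0. apply (Hmax (q t)). now apply Hb, Hq. }
  assert (T1 := T 1 Cmod_1). assert (T2 := T Ci Cmod_Ci).
  rewrite !dot_self, Cmod_mult in T1, T2. rewrite Cmod_1 in T1. rewrite Cmod_Ci in T2.
  replace (l * Ci * Ci)%C with (- l)%C in T2.
  2:{ destruct l. unfold Ci, Cmult, Copp; simpl. f_equal; ring. }
  replace (l * 1 * 1)%C with l in T1 by ring.
  assert (dot (h p) (- l) = - dot (h p) l) by (unfold dot, Copp; simpl; ring).
  assert (0 <= (Cmod (h1 p) * 1) ^ 2) by nra. lra.
Qed.

(** * Univalent functions and their inverses *)

Lemma ccont_real_Cmod_sub (f : C -> C) (z k : C) :
  ccont f z -> ccont_real (fun w => Cmod (f w - k)) z.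
Proof.
intros H eps He. destruct (H eps He) as (d & Hd & Hw). exists d. split; [easy|].
intros w Hb. specialize (Hw w Hb). apply Rabs_lt_between.
pose proof (Cmod_sub_triangle (f w) (f z) k). pose proof (Cmod_sub_triangle (f z) (f w) k).
rewrite (Cmod_sub_sym (f z) (f w)) in H1. lra.
Qed.

Lemma sphere_min (f : C -> C) (c k : C) (rho : R) : 0 < rho ->
  (forall z, Cmod (z - c) = rho -> ccont f z) ->
  (forall z, Cmod (z - c) = rho -> f z <> k) ->
  exists m, 0 < m /\ forall z, Cmod (z - c) = rho -> m <= Cmod (f z - k).
Proof.
intros Hrho Hc Hk.
destruct (compact_max (fun z => Cmod (z - c) = rho) (fun z => - Cmod (f z - k))
  (Cmod c + rho) (c + RtoC rho)%C) as (p & Hp & Hmax).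
- replace (c + RtoC rho - c)%C with (RtoC rho) by ring. rewrite Cmod_R, Rabs_pos_eq; lra.
- intros z Hz. pose proof (Cmod_le_add_sub z c). lra.
- intros p Hp. apply Rle_antisym; apply le_epsilon; intros e He;
  destruct (Hp e He) as (z & Hz & Hzp).
  + pose proof (Cmod_sub_triangle p z c). rewrite (Cmod_sub_sym p z) in H. lra.
  + pose proof (Cmod_sub_triangle z p c). lra.
- intros z Hz eps He. destruct (ccont_real_Cmod_sub f z k (Hc z Hz) eps He) as (d & Hd & Hw).
  exists d. split; [easy|]. intros w Hb. rewrite <- Rabs_Ropp.
  replace (- (- Cmod (f w - k) - - Cmod (f z - k))) with (Cmod (f w - k) - Cmod (f z - k)) by ring.
  now apply Hw.
- exists (Cmod (f p - k)). split. apply Cmod_sub_neq. now apply Hk.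
  intros z Hz. specialize (Hmax z Hz). lra.
Qed.

Lemma min_modulus (h h1 : C -> C) (c : C) (rho m : R) : 0 < rho -> 0 < m ->
  (forall z, Cmod (z - c) <= rho -> cdiff h z (h1 z)) ->
  (forall z, Cmod (z - c) <= rho -> h z <> 0) ->
  (forall z, Cmod (z - c) = rho -> m <= Cmod (h z)) ->
  forall z, Cmod (z - c) <= rho -> m <= Cmod (h z).
Proof.
intros Hrho Hm Hh H0 Hb z Hz.
assert (T := max_modulus (fun z => / h z)%C (fun z => - h1 z / (h z * h z))%C c rho (/ m) Hrho).
assert (T' : Cmod (/ h z) <= / m).
{ apply T; try easy.
  - intros w Hw. apply cdiff_inv. now apply Hh. now apply H0.
  - intros w Hw. rewrite Cmod_inv by (apply H0; lra). apply Rinv_le_contravar; [easy|]. now apply Hb. }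
rewrite Cmod_inv in T' by now apply H0.
assert (0 < Cmod (h z)) by (apply Cmod_gt_0; now apply H0).
apply Rinv_le_contravar in T'; [|now apply Rinv_0_lt_compat].
now rewrite !Rinv_inv in T'.
Qed.

(** If [w] is within [m / 2] of [f c] and is omitted, then [f - w] has no zero and is at least
    [m / 2] on the circle; the minimum principle contradicts its value at the centre. *)
Lemma open_mapping (f f1 : C -> C) (c : C) (rho : R) : 0 < rho ->
  (forall z, Cmod (z - c) <= rho -> cdiff f z (f1 z)) ->
  (forall z, Cmod (z - c) = rho -> f z <> f c) ->
  exists m, 0 < m /\ forall w, Cmod (w - f c) < m -> exists z, Cmod (z - c) <= rho /\ f z = w.
Proof.
intros Hrho Hf Hn.
destruct (sphere_min f c (f c) rho Hrho) as (m & Hm & Hmin); [|easy|].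
{ intros z Hz. eapply cdiff_ccont, Hf. lra. }
exists (m / 2). split. lra. intros w Hw. apply NNPP. intros Hno.
assert (T := min_modulus (fun z => f z - w)%C f1 c rho (m / 2) Hrho).
assert (T' : m / 2 <= Cmod (f c - w)).
{ apply T.
  - lra.
  - intros z Hz. apply (cdiff_eq_val _ _ (f1 z - 0)%C); [|ring].
    apply cdiff_minus. now apply Hf. apply cdiff_const.
  - intros z Hz E. apply Hno. exists z. split; [easy|]. now apply Ceq_minus.
  - intros z Hz. pose proof (Cmod_sub_triangle (f z) w (f c)). specialize (Hmin z Hz). lra.
  - rewrite Cmod_sub_self. lra. }
rewrite Cmod_sub_sym in T'. lra.
Qed.

(** A substitute for Riemann's removable singularity theorem: at [s] itself, differentiability of
    [f1] is enough for [slope_cdiff_at]. *)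
Lemma slope_holomorphic (f f1 : C -> C) (c s : C) (rho : R) :
  (forall z, Cmod (z - c) < rho -> cdiff f z (f1 z)) -> Cmod (s - c) < rho ->
  exists k, forall z, Cmod (z - c) < rho -> cdiff (slope f s (f1 s)) z (k z).
Proof.
intros Hf Hs.
assert (Hb : forall w, Cmod (w - s) < rho - Cmod (s - c) -> cdiff f w (f1 w)).
{ intros w Hw. apply Hf. pose proof (Cmod_sub_triangle w s c). lra. }
assert (Hk : forall z, exists k, Cmod (z - c) < rho -> cdiff (slope f s (f1 s)) z k).
{ intros z. destruct (Rlt_dec (Cmod (z - c)) rho) as [Hz|Hz]; [|now exists 0].
  destruct (Ceq_dec z s) as [->|Hne].
  - destruct (cdiff_derivative f f1 s (rho - Cmod (s - c))) as [k Hk]; [lra|easy|].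
    eexists. intros _. apply (slope_cdiff_at f f1 s k (rho - Cmod (s - c))); [lra|easy|easy].
  - destruct (cdiff_slope_away f s (f1 s) z (f1 z) Hne) as [k Hk]. now apply Hf.
    now exists k. }
exists (fun z => proj1_sig (constructive_indefinite_description _ (Hk z))).
intros z. now destruct constructive_indefinite_description.
Qed.

(* If [f1 c = 0], the minimum principle for the difference quotients [slope f s (f1 s)]
   forces [f1 s] to be either zero or bounded away from zero for [s] near [c]; by
   continuity [f1] vanishes near [c] and [f] is locally constant. *)
Lemma injective_derivative_neq0 (f f1 : C -> C) (c : C) (rho : R) : 0 < rho ->
  (forall z, Cmod (z - c) < rho -> cdiff f z (f1 z)) ->
  (forall z w, Cmod (z - c) < rho -> Cmod (w - c) < rho -> f z = f w -> z = w) ->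
  f1 c <> 0.
Proof.
intros Hrho Hf Hinj Hz0. set (r := rho / 2). assert (Hr : 0 < r < rho) by (unfold r; lra).
assert (Hcc : Cmod (c - c) < r) by (rewrite Cmod_sub_self; lra).
destruct (sphere_min f c (f c) r) as (m & Hm & Hmin). lra.
{ intros z Hz. eapply cdiff_ccont, Hf. lra. }
{ intros z Hz E. apply Hinj in E; try lra. subst z. lra. }
destruct (cdiff_derivative f f1 c rho Hrho Hf) as [l Hl].
(* For [f s] within [m / 2] of [f c], the quotient on the circle has numerator at least [m / 2] and
   denominator at most [2 * r]. So [m / (4 * r)] is the threshold below which a nonzero [f1 s] is
   impossible. *)
destruct (cdiff_ccont _ _ _ Hl (m / (4 * r))) as (d1 & Hd1 & Hw1). apply Rdiv_lt_0_compat; lra.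
destruct (cdiff_ccont _ _ _ (Hf c ltac:(lra)) (m / 2)) as (d2 & Hd2 & Hw2). lra.
set (d := Rmin (Rmin d1 d2) r).
assert (Hd : 0 < d) by (repeat apply Rmin_pos; lra).
assert (Hdd : d <= d1 /\ d <= d2 /\ d <= r).
{ unfold d. pose proof (Rmin_l (Rmin d1 d2) r). pose proof (Rmin_r (Rmin d1 d2) r).
  pose proof (Rmin_l d1 d2). pose proof (Rmin_r d1 d2). lra. }
assert (Hzero : forall s, Cmod (s - c) < d -> f1 s = 0).
{ intros s Hs. apply NNPP. intros Hs0.
  specialize (Hw1 s ltac:(lra)). specialize (Hw2 s ltac:(lra)).
  rewrite Hz0 in Hw1. replace (f1 s - 0)%C with (f1 s) in Hw1 by ring.
  destruct (slope_holomorphic f f1 c s rho Hf ltac:(lra)) as [k Hk].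
  assert (Hk' : forall z, Cmod (z - c) <= r -> cdiff (slope f s (f1 s)) z (k z)).
  { intros z Hz. apply Hk. lra. }
  assert (T := min_modulus _ k c r (m / (4 * r)) ltac:(lra) ltac:(apply Rdiv_lt_0_compat; lra) Hk').
  assert (T' : m / (4 * r) <= Cmod (slope f s (f1 s) s)).
  { apply T; [| |lra].
    - intros z Hz. destruct (Ceq_dec z s) as [->|Hne]. now rewrite slope_at.
      intros E. assert (E' := slope_eq f s (f1 s) z). rewrite E, Cmult_0_l in E'.
      apply Hne, Hinj; try lra. now apply Ceq_minus.
    - intros z Hz. assert (Hne : z <> s) by (intros ->; lra).
      rewrite slope_neq by easy. rewrite Cmod_div by now apply Cminus_eq_contra.
      specialize (Hmin z Hz). pose proof (Cmod_sub_triangle (f z) (f s) (f c)).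
      pose proof (Cmod_sub_triangle z c s). rewrite (Cmod_sub_sym c s) in H0.
      apply (Rle_div_r _ _ (Cmod (z - s))). now apply Cmod_sub_neq.
      apply Rle_trans with (m / (4 * r) * (2 * r)).
      + apply Rmult_le_compat_l. apply Rlt_le, Rdiv_lt_0_compat; lra. lra.
      + replace (m / (4 * r) * (2 * r)) with (m / 2) by (field; lra). lra. }
  rewrite slope_at in T'. lra. }
set (z := (c + RtoC (d / 2))%C).
assert (Hz : Cmod (z - c) = d / 2).
{ unfold z. replace (c + RtoC (d / 2) - c)%C with (RtoC (d / 2)) by ring.
  rewrite Cmod_R, Rabs_pos_eq; lra. }
assert (T := mean_value_ineq f f1 c z 0). rewrite Rmult_0_l in T.
assert (E : f z = f c).
{ apply Ceq_minus, Cmod_eq_0, Rle_antisym; [|apply Cmod_ge_0]. apply T.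
  - intros w Hw. apply Hf. lra.
  - intros w Hw. rewrite Hzero by lra. rewrite Cmod_0. lra. }
apply Hinj in E; try lra. rewrite E, Cmod_sub_self in Hz. lra.
Qed.

Lemma disk_ball (z w : C) : Cmod (w - z) < 1 - Cmod z -> Cmod w < 1.
Proof. intros H. pose proof (Cmod_le_add_sub w z). lra. Qed.

Section inverse.
Variables f f1 : C -> C.
Hypothesis Hf : forall z, Cmod z < 1 -> cdiff f z (f1 z).
Hypothesis Hinj : forall z w, Cmod z < 1 -> Cmod w < 1 -> f z = f w -> z = w.

Lemma univalent_open (z : C) (e : R) : Cmod z < 1 -> 0 < e ->
  exists m, 0 < m /\ forall w, Cmod (w - f z) < m ->
    exists x, Cmod x < 1 /\ Cmod (x - z) < e /\ f x = w.
Proof.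
intros Hz He. set (r := Rmin e (1 - Cmod z) / 2).
assert (H0 : 0 < Rmin e (1 - Cmod z)) by (apply Rmin_pos; lra).
pose proof (Rmin_l e (1 - Cmod z)). pose proof (Rmin_r e (1 - Cmod z)).
assert (Hr : 0 < r < e /\ r < 1 - Cmod z) by (unfold r; lra).
destruct (open_mapping f f1 z r) as (m & Hm & Hw). lra.
- intros x Hx. apply Hf, (disk_ball z). lra.
- intros x Hx E. apply Hinj in E; [|apply (disk_ball z); lra|easy].
  subst x. rewrite Cmod_sub_self in Hx. lra.
- exists m. split; [easy|]. intros w Hb. destruct (Hw w Hb) as (x & Hx & Ex).
  exists x. split; [apply (disk_ball z); lra|split; [lra|easy]].
Qed.

Lemma univalent_derivative_neq0 (z : C) : Cmod z < 1 -> f1 z <> 0.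
Proof.
intros Hz. apply (injective_derivative_neq0 f f1 z (1 - Cmod z)). lra.
- intros w Hw. apply Hf, (disk_ball z), Hw.
- intros w x Hw Hx. apply Hinj; apply (disk_ball z); assumption.
Qed.

(** Openness of [f] makes [g] continuous at [w0]. Then [g w - g w0] is [w - w0] times the reciprocal
    of the slope of [f] at [g w], and this factor is continuous since the derivative of [f] does not
    vanish. *)
Lemma inverse_cdiff (g : C -> C) (w0 : C) :
  (forall z, Cmod z < 1 -> g (f z) = z) -> (exists z, Cmod z < 1 /\ f z = w0) ->
  cdiff g w0 (/ f1 (g w0)).
Proof.
intros Hg (z0 & Hz0 & <-). rewrite (Hg z0 Hz0).
assert (Hgc : ccont g (f z0)).
{ intros e He. destruct (univalent_open z0 e Hz0 He) as (m & Hm & Hw).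
  exists m. split; [easy|]. intros w Hb. destruct (Hw w Hb) as (x & Hx1 & Hx2 & <-).
  now rewrite !Hg. }
assert (Hsc : ccont (slope f z0 (f1 z0)) z0) by now apply cdiff_slope, Hf.
assert (Hsg : ccont (fun w => slope f z0 (f1 z0) (g w)) (f z0)).
{ apply ccont_comp. easy. now rewrite Hg. }
assert (Hne : slope f z0 (f1 z0) (g (f z0)) <> 0).
{ rewrite Hg, slope_at by easy. now apply univalent_derivative_neq0. }
destruct (ccont_neq0 _ _ Hsg Hne) as (d & Hd & Hnz).
destruct (univalent_open z0 1 Hz0 Rlt_0_1) as (m & Hm & Hw).
eapply cdiff_eq_val.
- apply (cdiff_factor g (fun w => / slope f z0 (f1 z0) (g w))%C (f z0) (Rmin m d)).
  + now apply Rmin_pos.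
  + apply (ccont_comp Cinv (fun w => slope f z0 (f1 z0) (g w))). easy. now apply ccont_Cinv.
  + intros w Hb.
    destruct (Hw w (Rlt_le_trans _ _ _ Hb (Rmin_l _ _))) as (x & Hx & _ & Ex).
    specialize (Hnz w (Rlt_le_trans _ _ _ Hb (Rmin_r _ _))).
    rewrite <- Ex in *. rewrite !Hg in * by easy.
    rewrite (slope_eq f z0 (f1 z0) x). field. easy.
- cbv beta. now rewrite Hg, slope_at.
Qed.

End inverse.

(** * The Schwarz-Pick lemma *)

(** On [|z| = r] the quotient is at most [1 / r]; the maximum principle carries the bound inside,
    and [r] tends to 1. Using the completed quotient covers [z = 0], that is, the bound on the
    derivative. *)
Lemma schwarz_slope (k k1 : C -> C) (z : C) :
  (forall z, Cmod z < 1 -> cdiff k z (k1 z)) -> (forall z, Cmod z < 1 -> Cmod (k z) <= 1) ->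
  k 0 = 0 -> Cmod z < 1 -> Cmod (slope k 0 (k1 0) z) <= 1.
Proof.
intros Hk Hle H0 Hz.
assert (H01 : Cmod 0 < 1) by (rewrite Cmod_0; lra).
assert (Hsub : forall z, Cmod (z - 0) = Cmod z) by (intros x; f_equal; ring).
destruct (slope_holomorphic k k1 0 0 1) as [l Hl].
{ intros w Hw. rewrite Hsub in Hw. now apply Hk. } { now rewrite Hsub. }
assert (Hr : forall r, 0 < r < 1 -> Cmod z <= r -> Cmod (slope k 0 (k1 0) z) * r <= 1).
{ intros r Hr Hzr. apply Rle_div_r. lra.
  apply (max_modulus _ l 0 r); try lra.
  - intros x Hx. apply Hl. lra.
  - intros x Hx. rewrite Hsub in Hx.
    assert (Hx0 : x <> 0) by (intros ->; rewrite Cmod_0 in Hx; lra).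
    rewrite slope_neq, H0 by easy. rewrite Cmod_div by now apply Cminus_eq_contra.
    rewrite !Hsub, Hx. apply Rmult_le_compat_r. apply Rlt_le, Rinv_0_lt_compat; lra.
    apply Hle. lra.
  - now rewrite Hsub. }
apply Rnot_lt_le. intros Hgt. set (s := Cmod (slope k 0 (k1 0) z)) in *.
(* For [s > 1] the second entry is below 1 and its product with [s] is [(s + 1) / 2 > 1],
   contradicting [s * r <= 1]; the first entry keeps [z] in the disk of radius [r]. *)
set (r := Rmax (Cmod z) (/ 2 + / (2 * s))).
assert (Hs : 0 < / (2 * s) < / 2).
{ split. apply Rinv_0_lt_compat; lra. apply Rinv_lt_contravar; lra. }
assert (Hr1 : r < 1) by (apply Rmax_lub_lt; lra).
assert (Hr2 : / 2 + / (2 * s) <= r) by apply Rmax_r.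
specialize (Hr r ltac:(lra) (Rmax_l _ _)).
assert (s * (/ 2 + / (2 * s)) = s / 2 + / 2) by (field; lra). nra.
Qed.

(* Schwarz' lemma for [P / (P + 2 delta)], then [delta -> 0]. *)
Lemma nonneg_real_part_zero (P P1 : C -> C) (z : C) :
  (forall z, Cmod z < 1 -> cdiff P z (P1 z)) -> (forall z, Cmod z < 1 -> 0 <= fst (P z)) ->
  P 0 = 0 -> Cmod z < 1 -> P z = 0.
Proof.
intros HP Hre H0 Hz. apply Cmod_eq_0. apply Rle_antisym; [|apply Cmod_ge_0].
destruct (Ceq_dec z 0) as [->|Hz0]. { rewrite H0, Cmod_0. lra. }
assert (Hmain : forall d, 0 < d -> Cmod (P z) * (1 - Cmod z) <= 2 * d).
{ intros d Hd.
  assert (Hlt : forall x, Cmod x < 1 -> Cmod (P x) < Cmod (P x + RtoC (2 * d))).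
  { intros x Hx. specialize (Hre x Hx). 
    assert (Cmod (P x) ^ 2 < Cmod (P x + RtoC (2 * d)) ^ 2).
    { rewrite !Cmod_sqr. simpl. nra. }
    pose proof (Cmod_ge_0 (P x)). pose proof (Cmod_ge_0 (P x + RtoC (2 * d))). nra. }
  assert (Hne : forall x, Cmod x < 1 -> (P x + RtoC (2 * d))%C <> 0).
  { intros x Hx. apply Cmod_gt_0. specialize (Hlt x Hx). pose proof (Cmod_ge_0 (P x)). lra. }
  assert (S := schwarz_slope (fun x => P x / (P x + RtoC (2 * d)))%C
    (fun x => (P1 x * (P x + RtoC (2 * d)) - P x * (P1 x + 0)) /
      ((P x + RtoC (2 * d)) * (P x + RtoC (2 * d))))%C z).
  rewrite slope_neq, H0 in S by easy.
  replace (P z / (P z + RtoC (2 * d)) - 0 / (0 + RtoC (2 * d)))%C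
    with (P z / (P z + RtoC (2 * d)))%C in S
    by (unfold Cdiv at 3; ring).
  replace (z - 0)%C with z in S by ring.
  rewrite !Cmod_div in S by (try apply Hne; easy).
  assert (Hz' : 0 < Cmod z) by now apply Cmod_gt_0.
  assert (S' : Cmod (P z) / Cmod (P z + RtoC (2 * d)) / Cmod z <= 1).
  { apply S; try easy.
    - intros x Hx. apply (cdiff_div P (fun x => P x + RtoC (2 * d))%C).
      now apply HP. apply (cdiff_plus P (fun _ => RtoC (2 * d))). now apply HP.
      apply cdiff_const. now apply Hne.
    - intros x Hx. rewrite Cmod_div by now apply Hne. specialize (Hlt x Hx).
      apply Rle_div_l. pose proof (Cmod_ge_0 (P x)). lra. lra.
    - unfold Cdiv. ring. }
  specialize (Hlt z Hz). pose proof (Cmod_ge_0 (P z)).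
  apply (proj1 (Rle_div_l _ _ _ Hz')) in S'.
  apply (proj1 (Rle_div_l _ _ (Cmod (P z + RtoC (2 * d))) ltac:(lra))) in S'.
  pose proof (Cmod_triangle (P z) (RtoC (2 * d))). rewrite Cmod_R, Rabs_pos_eq in H1 by lra.
  assert (Cmod z * Cmod (P z + RtoC (2 * d)) <= Cmod z * (Cmod (P z) + 2 * d))
    by (apply Rmult_le_compat_l; lra).
  assert (Cmod z * (2 * d) <= 1 * (2 * d)) by (apply Rmult_le_compat_r; lra). lra. }
apply Rnot_lt_le. intros Hgt.
assert (0 < Cmod (P z) * (1 - Cmod z)) by (apply Rmult_lt_0_compat; lra).
specialize (Hmain (Cmod (P z) * (1 - Cmod z) / 4) ltac:(lra)). lra.
Qed.

(** The function [1 - Cconj (q 0) * q] has nonnegative real part and vanishes at 0, so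
    [nonneg_real_part_zero] makes it identically zero. *)
Lemma strong_max_modulus (q q1 : C -> C) (z : C) :
  (forall z, Cmod z < 1 -> cdiff q z (q1 z)) -> (forall z, Cmod z < 1 -> Cmod (q z) <= 1) ->
  Cmod (q 0) = 1 -> Cmod z < 1 -> q z = q 0.
Proof.
intros Hq Hle H0 Hz.
assert (E0 : (Cconj (q 0) * q 0)%C = 1).
{ rewrite Cmult_comm, <- Cmod2_conj, H0. f_equal. ring. }
assert (E := nonneg_real_part_zero (fun x => 1 - Cconj (q 0) * q x)%C
  (fun x => 0 - Cconj (q 0) * q1 x)%C z).
assert (E' : (1 - Cconj (q 0) * q z)%C = 0).
{ apply E; try easy.
  - intros x Hx. apply cdiff_minus. apply cdiff_const. now apply cdiff_scal, Hq.
  - intros x Hx. pose proof (Cmod_fst (Cconj (q 0) * q x)%C).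
    rewrite Cmod_mult, Cmod_conj, H0, Rmult_1_l in H. specialize (Hle x Hx).
    apply Rabs_le_between in H. unfold Cminus. simpl in *. lra.
  - cbv beta. rewrite E0. ring. }
transitivity (q 0 * (Cconj (q 0) * q z + (1 - Cconj (q 0) * q z)))%C.
- rewrite E'. rewrite Cplus_0_r, Cmult_assoc, (Cmult_comm (q 0)), E0. ring.
- ring.
Qed.

(** The disk automorphism sending [a] to 0; with parameter [- s] it sends 0 to [s]. *)
Definition mobius (a w : C) : C := ((w - a) / (1 - Cconj a * w))%C.

Lemma mobius_denom (a w : C) : Cmod a < 1 -> Cmod w < 1 -> (1 - Cconj a * w)%C <> 0.
Proof.
intros Ha Hw E. assert (E' : (Cconj a * w)%C = 1).
{ transitivity (1 - (1 - Cconj a * w))%C. ring. rewrite E. ring. }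
assert (T : Cmod (Cconj a * w) = 1) by now rewrite E', Cmod_1.
rewrite Cmod_mult, Cmod_conj in T. pose proof (Cmod_ge_0 a). pose proof (Cmod_ge_0 w). nra.
Qed.

Lemma mobius_disk (a w : C) : Cmod a < 1 -> Cmod w < 1 -> Cmod (mobius a w) < 1.
Proof.
intros Ha Hw. assert (Hd := mobius_denom a w Ha Hw). unfold mobius.
rewrite Cmod_div by easy. apply Rlt_div_l. now apply Cmod_gt_0. rewrite Rmult_1_l.
assert (E : Cmod (1 - Cconj a * w) ^ 2 - Cmod (w - a) ^ 2 = (1 - Cmod a ^ 2) * (1 - Cmod w ^ 2)).
{ rewrite !Cmod_sqr. destruct a, w. simpl. ring. }
pose proof (Cmod_ge_0 a). pose proof (Cmod_ge_0 w).
assert (0 < (1 - Cmod a ^ 2) * (1 - Cmod w ^ 2)) by (apply Rmult_lt_0_compat; nra).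
pose proof (Cmod_ge_0 (1 - Cconj a * w)). pose proof (Cmod_ge_0 (w - a)). nra.
Qed.

Lemma mobius_cdiff (a w : C) : Cmod a < 1 -> Cmod w < 1 ->
  cdiff (mobius a) w ((1 - Cconj a * a) / ((1 - Cconj a * w) * (1 - Cconj a * w))).
Proof.
intros Ha Hw. assert (Hd := mobius_denom a w Ha Hw). eapply cdiff_eq_val.
- apply (cdiff_div (fun w => w - a)%C (fun w => 1 - Cconj a * w)%C).
  + apply cdiff_minus. apply cdiff_id. apply cdiff_const.
  + apply cdiff_minus. apply cdiff_const. apply cdiff_scal, cdiff_id.
  + easy.
- field. easy.
Qed.

Lemma one_minus_conj_mult (a : C) : (1 - Cconj a * a)%C = RtoC (1 - Cmod a ^ 2).
Proof. now rewrite Cmult_comm, <- Cmod2_conj, RtoC_minus. Qed.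

Section schwarz_pick.
Variables h h1 : C -> C.
Hypothesis Hh : forall z, Cmod z < 1 -> cdiff h z (h1 z).
Hypothesis Hdisk : forall z, Cmod z < 1 -> Cmod (h z) < 1.

(** Normalizes [h] to fix the origin, so that Schwarz' lemma applies. *)
Let k (z : C) : C := mobius (h 0) (h z).
Let k1 (z : C) : C := ((1 - Cconj (h 0) * h 0) /
  ((1 - Cconj (h 0) * h z) * (1 - Cconj (h 0) * h z)) * h1 z)%C.

Let H01 : Cmod 0 < 1.
Proof. rewrite Cmod_0. lra. Qed.

Let Hk (z : C) : Cmod z < 1 -> cdiff k z (k1 z).
Proof.
intros Hz. unfold k, k1. apply (cdiff_comp (mobius (h 0)) h). now apply Hh.
apply mobius_cdiff; now apply Hdisk.
Qed.

Let Hk_disk (z : C) : Cmod z < 1 -> Cmod (k z) <= 1.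
Proof. intros Hz. apply Rlt_le, mobius_disk; now apply Hdisk. Qed.

Let Hk0 : k 0 = 0.
Proof. unfold k, mobius, Cdiv. ring. Qed.

Let gap_pos : 0 < 1 - Cmod (h 0) ^ 2.
Proof. pose proof (Hdisk 0 H01). pose proof (Cmod_ge_0 (h 0)). nra. Qed.

Let Hk10 : Cmod (k1 0) = Cmod (h1 0) / (1 - Cmod (h 0) ^ 2).
Proof.
unfold k1. rewrite one_minus_conj_mult.
assert (RtoC (1 - Cmod (h 0) ^ 2) <> 0) by (intros E; apply RtoC_inj in E; lra).
rewrite Cmod_mult, Cmod_div, Cmod_mult, Cmod_R, Rabs_pos_eq by (try lra; now apply Cmult_neq_0).
field. lra.
Qed.

Lemma schwarz_pick : Cmod (h1 0) <= 1 - Cmod (h 0) ^ 2.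
Proof.
assert (S := schwarz_slope k k1 0 Hk Hk_disk Hk0 H01).
rewrite slope_at, Hk10 in S. apply Rle_div_l in S; lra.
Qed.

(** Equality means that the completed quotient of [k] has modulus 1 at the centre, hence is
    constant. So [k] is a rotation, and undoing the automorphism shows that [h] is onto. *)
Lemma schwarz_pick_eq_surjective : Cmod (h1 0) = 1 - Cmod (h 0) ^ 2 ->
  forall y, Cmod y < 1 -> exists x, Cmod x < 1 /\ h x = y.
Proof.
intros Heq y Hy.
assert (Hsub : forall z, Cmod (z - 0) = Cmod z) by (intros x; f_equal; ring).
assert (Hq1 : Cmod (k1 0) = 1) by (rewrite Hk10, Heq; field; lra).
destruct (slope_holomorphic k k1 0 0 1) as [l Hl].
{ intros w Hw. rewrite Hsub in Hw. now apply Hk. } { now rewrite Hsub. }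
assert (Hrot : forall x, Cmod x < 1 -> k x = (k1 0 * x)%C).
{ intros x Hx. assert (E := slope_eq k 0 (k1 0) x).
  rewrite (strong_max_modulus (slope k 0 (k1 0)) l x) in E.
  - rewrite slope_at, Hk0 in E. transitivity (k x - 0)%C. ring. rewrite E. ring.
  - intros w Hw. apply Hl. now rewrite Hsub.
  - intros w Hw. now apply schwarz_slope.
  - now rewrite slope_at.
  - easy. }
assert (Hn : k1 0 <> 0) by (apply Cmod_gt_0; lra).
set (x := (mobius (h 0) y / k1 0)%C).
assert (Ha := Hdisk 0 H01).
assert (Hx : Cmod x < 1).
{ unfold x. rewrite Cmod_div, Hq1, Rdiv_1_r by easy. now apply mobius_disk. }
exists x. split; [easy|].
assert (E : mobius (h 0) (h x) = mobius (h 0) y).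
{ change (k x = mobius (h 0) y). rewrite Hrot by easy. unfold x. field. easy. }
assert (D1 := mobius_denom (h 0) (h x) Ha (Hdisk x Hx)).
assert (D2 := mobius_denom (h 0) y Ha Hy).
unfold mobius in E.
assert (E2 : ((h x - h 0) * (1 - Cconj (h 0) * y) = (y - h 0) * (1 - Cconj (h 0) * h x))%C).
{ transitivity ((h x - h 0) / (1 - Cconj (h 0) * h x) * ((1 - Cconj (h 0) * h x) * (1 - Cconj (h 0) * y)))%C.
  field. easy. rewrite E. field. easy. }
(* Injectivity of the automorphism by cross-multiplication; the second factor is the positive number
   [1 - |h 0|^2]. *)
assert (E3 : ((h x - y) * (1 - Cconj (h 0) * h 0))%C = 0).
{ transitivity ((h x - h 0) * (1 - Cconj (h 0) * y) - (y - h 0) * (1 - Cconj (h 0) * h x))%C.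
  ring. rewrite E2. ring. }
apply Ceq_minus, NNPP. intros Hne. apply (Cmult_neq_0 _ (1 - Cconj (h 0) * h 0)%C) in Hne; [easy|].
rewrite one_minus_conj_mult. intros E4. apply RtoC_inj in E4. lra.
Qed.

End schwarz_pick.

(** * Convex mappings *)

Section convex.
Variables (f f1 g : C -> C) (a2 : C).
Hypothesis Hf : forall z, Cmod z < 1 -> cdiff f z (f1 z).
Hypothesis Hinj : forall z w, Cmod z < 1 -> Cmod w < 1 -> f z = f w -> z = w.
Hypothesis Hg : forall z, Cmod z < 1 -> g (f z) = z.

(** Schwarz-Pick for the self-map [g o F] of the disk, whose derivative at 0 is [F1 0 / f1 x]. The
    right-hand side is the conformal radius of the image at [F 0], and the equality case makes [F]
    cover the whole image. *)
Lemma subordination (F F1 : C -> C) :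
  (forall z, Cmod z < 1 -> cdiff F z (F1 z)) ->
  (forall z, Cmod z < 1 -> disk_image f (F z)) ->
  let x := g (F 0) in
  Cmod (F1 0) <= Cmod (f1 x) * (1 - Cmod x ^ 2) /\
  (Cmod (F1 0) = Cmod (f1 x) * (1 - Cmod x ^ 2) ->
   forall y, Cmod y < 1 -> exists z, Cmod z < 1 /\ F z = f y).
Proof.
intros HF HFi x.
assert (Hgi : forall z, Cmod z < 1 -> Cmod (g (F z)) < 1 /\ f (g (F z)) = F z).
{ intros z Hz. destruct (HFi z Hz) as (v & Hv & <-). now rewrite Hg. }
set (h := fun z => g (F z)). set (h1 := fun z => (/ f1 (h z) * F1 z)%C).
assert (Hh : forall z, Cmod z < 1 -> cdiff h z (h1 z)).
{ intros z Hz. apply (cdiff_comp g F). now apply HF.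
  apply (inverse_cdiff f f1 Hf Hinj g (F z) Hg).
  destruct (HFi z Hz) as (v & Hv & E). now exists v. }
assert (Hd : forall z, Cmod z < 1 -> Cmod (h z) < 1) by (intros z Hz; now apply Hgi).
assert (H01 : Cmod 0 < 1) by (rewrite Cmod_0; lra).
assert (Hn : 0 < Cmod (f1 x)).
{ apply Cmod_gt_0, (univalent_derivative_neq0 f f1); try easy. now apply Hgi. }
assert (E : Cmod (h1 0) = Cmod (F1 0) / Cmod (f1 x)).
{ unfold h1. rewrite Cmod_mult, Cmod_inv by now apply Cmod_gt_0.
  unfold h. fold x. field. lra. }
assert (S := schwarz_pick h h1 Hh Hd). change (h 0) with x in S. rewrite E in S.
split.
- rewrite Rmult_comm. now apply Rle_div_l.
- intros Heq y Hy.
  destruct (schwarz_pick_eq_surjective h h1 Hh Hd) with (y := y) as (z & Hz & Ez); [|easy|].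
  + rewrite E, Heq. change (h 0) with x. field. lra.
  + exists z. split; [easy|]. rewrite <- Ez. symmetry. now apply Hgi.
Qed.

Hypothesis Hconv : convex_set (disk_image f).
Hypothesis Hf0 : f 0 = 0.
Hypothesis Hf10 : f1 0 = 1.
Hypothesis Ha2 : cdiff f1 0 (RtoC 2 * a2).

Lemma conformal_radius_le (s : C) : Cmod s < 1 ->
  Cmod (f1 s) * (1 - Cmod s ^ 2) <= 1 + 2 * fst (a2 * f s)%C.
Proof.
intros Hs.
assert (H01 : Cmod 0 < 1) by (rewrite Cmod_0; lra).
assert (Hn : f1 s <> 0) by (apply (univalent_derivative_neq0 f f1); easy).
assert (Hn' : 0 < Cmod (f1 s)) by now apply Cmod_gt_0.
(* A rotation of the variable making the derivative of [f o m] at 0 the positive real [Rs], so that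
   the derivatives 1 and [Rs] add without cancellation in the convex combination. *)
set (eta := (RtoC (Cmod (f1 s)) / f1 s)%C).
assert (Heta : Cmod eta = 1).
{ unfold eta. rewrite Cmod_div, Cmod_R, Rabs_pos_eq by (try easy; lra). field. lra. }
set (Rs := Cmod (f1 s) * (1 - Cmod s ^ 2)).
set (m := fun z => mobius (- s) (eta * z)).
set (m1 := fun z => ((1 - Cconj (- s) * - s) /
  ((1 - Cconj (- s) * (eta * z)) * (1 - Cconj (- s) * (eta * z))) * eta)%C).
assert (Hms : Cmod (- s) < 1) by now rewrite Cmod_opp.
assert (Hez : forall z, Cmod z < 1 -> Cmod (eta * z) < 1).
{ intros z Hz. rewrite Cmod_mult, Heta. lra. }
assert (Hm : forall z, Cmod z < 1 -> cdiff m z (m1 z)).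
{ intros z Hz. apply (cdiff_comp (mobius (- s)) (fun z => eta * z)%C).
  - eapply cdiff_eq_val. apply cdiff_scal, cdiff_id. ring.
  - apply mobius_cdiff. easy. now apply Hez. }
assert (Hmd : forall z, Cmod z < 1 -> Cmod (m z) < 1).
{ intros z Hz. apply mobius_disk. easy. now apply Hez. }
assert (Hm0 : m 0 = s).
{ unfold m, mobius. rewrite !Cmult_0_r. field. }
assert (Hm10 : (f1 s * m1 0)%C = RtoC Rs).
{ unfold m1. rewrite one_minus_conj_mult, Cmod_opp, !Cmult_0_r.
  transitivity (RtoC (1 - Cmod s ^ 2) * (f1 s * eta))%C. field.
  unfold eta, Rs. rewrite RtoC_mult. field. easy. }
(* The factor [1 - |x|^2] is dropped here: [x] is of order [t], so the loss is of second order and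
   does not affect the comparison of slopes at [t = 0]. *)
assert (Hineq : forall t, 0 <= t <= 1 -> 1 - t + t * Rs <= Cmod (f1 (g (RtoC t * f s)%C))).
{ intros t Ht.
  destruct (subordination (fun z => RtoC (1 - t) * f z + RtoC t * f (m z))%C
    (fun z => RtoC (1 - t) * f1 z + RtoC t * (f1 (m z) * m1 z))%C) as [L _].
  - intros z Hz. apply cdiff_plus; apply cdiff_scal. now apply Hf.
    apply (cdiff_comp f m). now apply Hm. now apply Hf, Hmd.
  - intros z Hz. apply Hconv; [now exists z| |easy]. exists (m z). split; [now apply Hmd|easy].
  - cbv beta zeta in L. rewrite Hm0, Hf0, Hf10, Hm10 in L.
    replace (RtoC (1 - t) * 0 + RtoC t * f s)%C with (RtoC t * f s)%C in L by ring.
    rewrite Cmult_1_r, <- RtoC_mult, <- RtoC_plus, Cmod_R in L.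
    eapply Rle_trans. apply Rle_abs. eapply Rle_trans. apply L.
    set (x := Cmod (f1 _)). assert (0 <= x) by apply Cmod_ge_0. nra. }
set (G := fun t => f1 (g (RtoC t * f s))%C).
assert (Hg0 : g 0 = 0) by (rewrite <- (Hg 0 H01) at 2; now rewrite Hf0).
assert (HG0 : G 0 = 1) by (unfold G; now rewrite Cmult_0_l, Hg0).
assert (HG : pder G 0 (RtoC 2 * a2 * f s)).
{ eapply pder_eq_val.
  - apply (pder_comp (fun w => f1 (g w)) (fun t => RtoC t * f s)%C).
    + apply (pder_ext _ (fun t => 0 + RtoC t * f s)%C). intros; ring. apply pder_line.
    + rewrite Cmult_0_l. apply (cdiff_comp f1 g).
      * apply (inverse_cdiff f f1); try easy. now exists 0.
      * rewrite Hg0. exact Ha2.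
  - rewrite Hg0, Hf10. field. }
(* Squared moduli are compared because [|G|^2] is a polynomial in the components. Its slope at 0 is
   [4 * A], against at least [2 * (Rs - 1)] for the lower bound, whose quadratic term is nonnegative
   and is discarded. *)
assert (HN := pder_dot G G 0 _ _ HG HG). rewrite <- is_derive_Reals, is_derive_eps in HN.
rewrite HG0, dot_self, Cmod_1 in HN.
set (A := fst (a2 * f s)%C) in *.
assert (EA : dot (RtoC 2 * a2 * f s) 1 + dot 1 (RtoC 2 * a2 * f s) = 4 * A).
{ unfold dot, A. simpl. ring. }
rewrite EA in HN. fold Rs.
apply le_epsilon. intros eps He. destruct (HN (2 * eps)) as (d & Hd & Hw). lra.
set (t := Rmin d 1 / 2). assert (H0 : 0 < Rmin d 1) by (apply Rmin_pos; lra).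
pose proof (Rmin_l d 1). pose proof (Rmin_r d 1).
assert (Ht : 0 < t <= 1 /\ t < d) by (unfold t; lra).
specialize (Hw t). rewrite Rminus_0_r, Rabs_pos_eq in Hw by lra.
specialize (Hw ltac:(lra)). rewrite ?dot_self in Hw. apply Rabs_le_between in Hw.
specialize (Hineq t ltac:(lra)). fold (G t) in Hineq.
assert (HRs : 0 <= Rs).
{ apply Rmult_le_pos. lra. pose proof (Cmod_ge_0 s). nra. }
assert (0 <= t * Rs) by (apply Rmult_le_pos; lra).
assert (0 <= 1 - t + t * Rs) by lra.
assert ((1 - t + t * Rs) ^ 2 <= Cmod (G t) ^ 2) by (apply pow_incr; lra).
assert (0 <= (t * (Rs - 1)) ^ 2) by apply pow2_ge_0.
replace ((1 - t + t * Rs) ^ 2) with (1 + t * (2 * (Rs - 1)) + (t * (Rs - 1)) ^ 2) in H4 by ring.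
assert (Hfin : t * (2 * (Rs - 1)) <= t * (4 * A + 2 * eps)) by lra.
apply Rmult_le_reg_l in Hfin; lra.
Qed.

Hypothesis Hbdd : bounded_set (disk_image f).

(* At a boundary value [ws] with [1 + 2 Re (a2 ws) <= 0], the map [(f + ws) / 2] into the
   image attains equality in the Schwarz-Pick lemma, so it is onto: the image is invariant
   under the dilation of ratio 2 centred at [ws], hence unbounded. *)
Lemma no_boundary_equality (ws : C) :
  (forall eps, 0 < eps -> exists w, disk_image f w /\ Cmod (w - ws) < eps) ->
  1 + 2 * fst (a2 * ws)%C <= 0 -> False.
Proof.
intros Hcl Hle.
assert (H01 : Cmod 0 < 1) by (rewrite Cmod_0; lra).
set (F := fun z => (/ RtoC 2 * (f z + ws))%C).
assert (HFi : forall z, Cmod z < 1 -> disk_image f (F z)).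
{ intros z Hz. destruct (univalent_open f f1 Hf Hinj z 1 Hz Rlt_0_1) as (m & Hm & Hw).
  destruct (Hcl m Hm) as (w & Hw1 & Hw2).
  destruct (Hw (f z + ws - w)%C) as (x & Hx & _ & Ex).
  { replace (f z + ws - w - f z)%C with (ws - w)%C by ring. now rewrite Cmod_sub_sym. }
  replace (F z) with (RtoC (1 - / 2) * f x + RtoC (/ 2) * w)%C.
  - apply Hconv; [now exists x|easy|lra].
  - rewrite Ex. unfold F. replace (1 - / 2) with (/ 2) by field. rewrite RtoC_inv by lra. ring. }
destruct (subordination F (fun z => / RtoC 2 * f1 z)%C) as [L Honto]; [|easy|].
{ intros z Hz. apply cdiff_scal. eapply cdiff_eq_val. apply cdiff_plus. now apply Hf.
  apply cdiff_const. ring. }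
set (x := g (F 0)) in *.
assert (Hx : Cmod x < 1 /\ f x = F 0).
{ unfold x. destruct (HFi 0 H01) as (v & Hv & <-). now rewrite Hg. }
(* Since [f x = ws / 2], the conformal radius at that point is at most [1 + Re (a2 ws) <= 1/2],
   while [L] bounds it below by the derivative [1/2] of [F] at 0: equality holds. *)
assert (K := conformal_radius_le x (proj1 Hx)).
assert (EF : (a2 * f x)%C = (RtoC (/ 2) * (a2 * ws))%C).
{ rewrite (proj2 Hx). unfold F. rewrite Hf0, RtoC_inv by lra. ring. }
rewrite EF in K.
assert (EK : fst (RtoC (/ 2) * (a2 * ws))%C = / 2 * fst (a2 * ws)%C) by (simpl; ring).
rewrite EK in K.
assert (E1 : Cmod (/ RtoC 2 * f1 0) = / 2).
{ rewrite Hf10, Cmult_1_r, <- RtoC_inv, Cmod_R, Rabs_pos_eq; lra. }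
(* Surjectivity of [F] onto the image says that [2 w - ws] is in the image whenever [w] is; the
   iteration starts at 0, and [ws] is nonzero by [Hle]. *)
assert (Hdil : forall n, exists w, disk_image f w /\ Cmod (w - ws) = 2 ^ n * Cmod ws).
{ induction n as [|n (w & (y & Hy & Ey) & Hw)].
  - exists 0. split. now exists 0. replace (0 - ws)%C with (- ws)%C by ring.
    rewrite Cmod_opp. simpl. ring.
  - destruct (Honto ltac:(lra) y Hy) as (z & Hz & Ez). exists (f z). split. now exists z.
    rewrite Ey in Ez. replace (f z - ws)%C with (RtoC 2 * (w - ws))%C.
    + rewrite Cmod_mult, Cmod_R, Hw, Rabs_pos_eq by lra. simpl. ring.
    + rewrite <- Ez. unfold F. field. }
destruct Hbdd as [M HM].
assert (Hws : 0 < Cmod ws).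
{ apply Cmod_gt_0. intros E. rewrite E, Cmult_0_r in Hle. simpl in Hle. lra. }
destruct (Pow_x_infinity 2) with (b := (M + Cmod ws) / Cmod ws + 1) as [N HN].
{ rewrite Rabs_pos_eq; lra. }
specialize (HN N (le_n N)). rewrite Rabs_pos_eq in HN by (apply pow_le; lra).
destruct (Hdil N) as (w & Hw & E). specialize (HM w Hw).
pose proof (Cmod_sub_triangle w 0 ws).
replace (w - 0)%C with w in H by ring. replace (0 - ws)%C with (- ws)%C in H by ring.
rewrite Cmod_opp in H.
assert (((M + Cmod ws) / Cmod ws + 1) * Cmod ws <= 2 ^ N * Cmod ws)
  by (apply Rmult_le_compat_r; lra).
replace (((M + Cmod ws) / Cmod ws + 1) * Cmod ws) with (M + Cmod ws + Cmod ws) in H0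
  by (field; lra).
lra.
Qed.

Lemma real_part_bounded_away :
  exists b, - (1 / 2) < b /\ forall z, Cmod z < 1 -> b <= fst (a2 * f z)%C.
Proof.
apply NNPP. intros Hno.
assert (Hseq : forall n : nat, exists z, Cmod z < 1 /\ fst (a2 * f z)%C < - (1 / 2) + / (INR n + 1)).
{ intros n. apply NNPP. intros Hn. apply Hno. exists (- (1 / 2) + / (INR n + 1)). split.
  - assert (0 < / (INR n + 1)) by (apply Rinv_0_lt_compat; pose proof (pos_INR n); lra). lra.
  - intros z Hz. apply Rnot_lt_le. intros Hlt. apply Hn. now exists z. }
set (u := fun n => proj1_sig (constructive_indefinite_description _ (Hseq n))).
assert (Hu : forall n, Cmod (u n) < 1 /\ fst (a2 * f (u n))%C < - (1 / 2) + / (INR n + 1)).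
{ intros n. unfold u. now destruct constructive_indefinite_description. }
destruct Hbdd as [M HM].
destruct (C_cluster (fun n => f (u n)) M) as [ws Hws].
{ intros n. apply HM. exists (u n). split; [apply Hu|easy]. }
apply (no_boundary_equality ws).
- intros eps He. destruct (Hws eps He 0%nat) as (n & _ & Hn). exists (f (u n)).
  split; [|easy]. exists (u n). split; [apply Hu|easy].
- apply le_epsilon. intros eps He. rewrite Rplus_0_l.
  destruct (archimed_cor1 (eps / 4)) as (N0 & HN0 & HN1). lra.
  (* Passing from [f (u n)] to [ws] changes [Re (a2 w)] by less than [eps / 4], as much as
     [/ (INR n + 1)] contributes; doubling both gives [eps]. The [+ 1] allows [a2 = 0]. *)
  set (k := 4 * (Cmod a2 + 1)). pose proof (Cmod_ge_0 a2).
  destruct (Hws (eps / k) ltac:(apply Rdiv_lt_0_compat; unfold k; lra) N0) as (n & Hn & Hd).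
  assert (/ (INR n + 1) <= / INR N0).
  { apply Rinv_le_contravar. now apply lt_0_INR.
    assert (INR N0 <= INR n) by (apply le_INR; lia). lra. }
  destruct (Hu n) as [_ Hun]. pose proof (Cmod_fst (a2 * (f (u n) - ws))%C) as T.
  rewrite Cmod_mult in T. apply Rabs_le_between in T.
  apply Rlt_div_r in Hd; [|unfold k; lra]. unfold k in Hd.
  assert (E : fst (a2 * (f (u n) - ws))%C = fst (a2 * f (u n))%C - fst (a2 * ws)%C)
    by (simpl; ring).
  pose proof (Cmod_ge_0 (f (u n) - ws)). nra.
Qed.

End convex.

Theorem corollary2p2 :
  forall f : C -> C,
    convex_mapping f ->
    bounded_set (disk_image f) ->
    exists b : R,
      - (1 / 2) < b /\
      forall z : C, unit_disk z -> b <= Re (second_taylor_coeff f * f z)%C.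
Proof.
intros f [Han Hun Hf0 Hf10 Hconv] Hbdd.
assert (Hf : forall z, Cmod z < 1 -> cdiff f z (C_derive f z)).
{ intros z Hz. destruct (Han z Hz) as [l Hl]. rewrite (is_C_derive_unique f z l Hl).
  now apply cdiff_is_derive. }
(* This makes the iterated [C_derive] in [second_taylor_coeff] a genuine second derivative at 0, so
   that [2 * a2 = l]. *)
destruct (cdiff_derivative f (C_derive f) 0 1) as [l Hl]. lra.
{ intros z Hz. apply Hf. replace z with (z - 0)%C by ring. exact Hz. }
set (g := fun w => epsilon (inhabits (RtoC 0)) (fun z => Cmod z < 1 /\ f z = w)).
assert (Hg : forall z, Cmod z < 1 -> g (f z) = z).
{ intros z Hz. destruct (epsilon_spec (inhabits (RtoC 0)) (fun x => Cmod x < 1 /\ f x = f z)) as [H1 H2].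
  now exists z. now apply Hun. }
apply (real_part_bounded_away f (C_derive f) g); try easy.
apply (cdiff_eq_val _ _ l); [easy|]. unfold second_taylor_coeff.
rewrite (is_C_derive_unique (C_derive f) 0 l) by now apply cdiff_is_derive.
field.
Qed.
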